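(* Let $\tau_0,\tau_1>0$, $\mathfrak r=\tau_0\tau_1/[2(\tau_0+\tau_1)]$, and let $g^{\rm U}$ be the Riemannian metric on $\mathcal G_d^+$ defined in the context. Define on $\mathcal G_d^1$ the metric $$h_{\mathfrak r,\mu}:=\frac1{4\mathfrak r}\left(g_{\mathrm{BW},\mu}:\mathfrak r\,g_{\mathrm{FR},\mu}\right)\qquad(\mu\in\mathcal G_d^1),$$ and the radial mass coordinate $\varrho=2\sqrt{\mathfrak r a}$, i.e. $a=\varrho^2/(4\mathfrak r)$. Under the diffeomorphism $\mathcal G_d^+\ni a\mu\mapsto(\varrho,\mu)\in(0,\infty)\times\mathcal G_d^1$, the tensor $g^{\rm U}$ becomes $$g^{\rm U}=d\varrho^2+\varrho^2h_{\mathfrak r}.$$ Thus $(\mathcal G_d^+,g^{\rm U})$ is isometric to the open Riemannian cone over $(\mathcal G_d^1,h_{\mathfrak r})$. In particular, along a fixed normalized shape $\mu\in\mathcal G_d^1$, radial curves are geodesics for the Riemannian metric $g^{\rm U}$, and for all $a_0,a_1>0$ $$d_{g^{\rm U}}(a_0\mu,a_1\mu)=2\sqrt{\mathfrak r}\,\left|\sqrt{a_1}-\sqrt{a_0}\right|,$$ where $d_{g^{\rm U}}$ is the Riemannian distance. The metric completion in the radial direction adds a cone apex at zero mass: as $a\downarrow0$, the radial rays $a\mu$ over all shapes $\mu\in\mathcal G_d^1$ determine one common point of the metric completion of $(\mathcal G_d^+,d_{g^{\rm U}})$, and its distance from $a\mu$ is $2\sqrt{\mathfrak r a}$.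
   Context: $\mathbb S^d$, $\mathbb S_{++}^d$: real symmetric, resp. symmetric positive-definite, $d\times d$ matrices. $\mathcal G_d^1=\{\mathcal N(m,\Sigma):m\in\mathbb R^d,\Sigma\in\mathbb S_{++}^d\}$, identified with the open set $\mathbb R^d\times\mathbb S_{++}^d$; tangent vectors at $\mu=\mathcal N(m,\Sigma)$ are $\xi=(\dot m,H)\in\mathbb R^d\times\mathbb S^d$. $\mathcal G_d^+=\{a\nu:a>0,\nu\in\mathcal G_d^1\}$. With $\mathcal L_\Sigma(X)=\Sigma X+X\Sigma$, $$g_{\mathrm{BW},\mu}(\xi,\xi)=\|\dot m\|^2+\tfrac12\operatorname{tr}(H\mathcal L_\Sigma^{-1}H),\qquad g_{\mathrm{FR},\mu}(\xi,\xi)=\dot m^\top\Sigma^{-1}\dot m+\tfrac12\operatorname{tr}(\Sigma^{-1}H\Sigma^{-1}H).$$ The parallel sum of positive-definite quadratic forms is $(G:H)(\xi,\xi)=\inf_\eta\{G(\eta,\eta)+H(\xi-\eta,\xi-\eta)\}$ (in matrix form, $(G^{-1}+H^{-1})^{-1}$). The Riemannian metric $g^{\rm U}$ on $\mathcal G_d^+$ is, at $\alpha=a\mu$ and for tangent vector $(\dot a,\xi)$, $$g_\alpha^{\rm U}\big((\dot a,\xi),(\dot a,\xi)\big)=\frac{\mathfrak r}{a}\dot a^2+a\left(g_{\mathrm{BW},\mu}:\mathfrak r\,g_{\mathrm{FR},\mu}\right)(\xi,\xi).$$ *)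

(* Defs.v *)
From HB Require Import structures.
From mathcomp Require Import all_boot all_order all_algebra.
From mathcomp Require Import all_classical all_reals all_analysis.
Set Implicit Arguments.
Unset Strict Implicit.
Unset Printing Implicit Defensive.
Import Order.TTheory GRing.Theory Num.Theory.
Import numFieldNormedType.Exports.
Local Open Scope classical_set_scope.
Local Open Scope ring_scope.

Section Smooth.
Context {R : realType} {V W : normedModType R}.

(* In finite dimension, all iterated directional derivatives exist and are
   continuous up to order k; meaningful for U open. *)
Fixpoint Ck_on (k : nat) (U : set V) (f : V -> W) : Prop :=
  match k with
  | 0 => forall x, U x -> {for x, continuous f}
  | k'.+1 => (forall x, U x -> differentiable f x) /\
             (forall v, Ck_on k' U (fun x => 'D_v f x))
  end.

Definition smooth_on (U : set V) (f : V -> W) : Prop := forall k, Ck_on k U f.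

(* Smoothness on a set that need not be open: a smooth extension exists. *)
Definition smooth_map (A : set V) (f : V -> W) : Prop :=
  exists U F, [/\ open U, A `<=` U, forall x, A x -> f x = F x & smooth_on U F].

End Smooth.

(* A Riemannian manifold with a single global chart: [carrier] is a subset of
   the normed space E, relatively open in a translate of the linear subspace
   [tangent], which is the tangent space at every point.  The metric tensor is
   given by its quadratic form, [metric x v] = g_x(v, v). *)
Record riem_space (R : realType) (E : normedModType R) := RiemSpace {
  carrier : set E;
  tangent : set E;
  metric : E -> E -> R }.

Section Riemannian.
Context {R : realType} {E : normedModType R}.
Variable X : riem_space E.

Definition inner (x v w : E) : R :=
  (metric X x (v + w) - metric X x (v - w)) / 4.

(* A curve is C^1 on a closed interval iff it is there the restriction of a
   curve that is C^1 on the whole line. *)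
Definition C1_curve (c : R -> E) : Prop :=
  (forall t, derivable c t 1) /\ continuous (derive1 c).

(* 0 < s_0 < ... < s_k = 1 are the break points. *)
Definition piecewise_C1 (c : R -> E) : Prop :=
  exists s : seq R, [/\ path <%R 0 s, last 0 s = 1 &
    forall i, (i < size s)%N -> exists2 c', C1_curve c' &
      forall t, nth 0 (0 :: s) i <= t <= nth 0 s i -> c t = c' t].

Definition admissible (c : R -> E) : Prop :=
  (forall t, 0 <= t <= 1 -> carrier X (c t)) /\ piecewise_C1 c.

Definition curve_length (c : R -> E) : \bar R :=
  (\int[lebesgue_measure]_(t in `[0%R, 1%R])
     (Num.sqrt (metric X (c t) (derive1 c t)))%:E)%E.

Definition riem_dist (x y : E) : \bar R :=
  ereal_inf [set curve_length c | c in
    [set c | [/\ admissible c, c 0 = x & c 1 = y]]].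

(* The geodesic equation: for a constant vector field w in the chart, Koszul's
   formula gives
     g(nabla_{c'} c', w) = d/dt g_{c(t)}(c'(t), w) - (1/2) D_w g(c', c'),
   where c'(t) is frozen in the last term. *)
Definition geodesic_on (I : set R) (c : R -> E) : Prop :=
  [/\ forall t, I t -> carrier X (c t), smooth_on I c &
      forall t w, I t -> tangent X w ->
        derivable (fun x => metric X x (derive1 c t)) (c t) w /\
        is_derive t (1 : R) (fun s => inner (c s) (derive1 c s) w)
          (2^-1 * 'D_w (fun x => metric X x (derive1 c t)) (c t))].

(* The open cone (0, oo) x X with metric drho^2 + rho^2 g. *)
Definition riem_cone : riem_space (R * E)%type :=
  RiemSpace [set y : (R * E)%type | 0 < y.1 /\ carrier X y.2]
            [set w : (R * E)%type | tangent X w.2]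
            (fun y w : (R * E)%type => w.1 ^+ 2 + y.1 ^+ 2 * metric X y.2 w.2).

End Riemannian.

(* f is a diffeomorphism with inverse g and pulls back the metric of Y to that
   of X.  For v tangent to X, 'D_v f only depends on f on [carrier X]. *)
Definition riem_isometry (R : realType) (E F : normedModType R)
    (X : riem_space E) (Y : riem_space F) (f : E -> F) (g : F -> E) : Prop :=
  [/\ forall x, carrier X x -> carrier Y (f x) /\ g (f x) = x,
      forall y, carrier Y y -> carrier X (g y) /\ f (g y) = y,
      smooth_map (carrier X) f,
      smooth_map (carrier Y) g &
      forall x v, carrier X x -> tangent X v ->
        tangent Y ('D_v f x) /\ metric Y (f x) ('D_v f x) = metric X x v].

(* The metric completion of (M, dist): Cauchy sequences modulo the relation
   dist (x n) (y n) --> 0, each class being represented as a set of sequences. *)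
Section Completion.
Context {R : realType} {E : pointedType}.
Variables (M : set E) (dist : E -> E -> \bar R).

Definition cauchy_seq_in (x : nat -> E) : Prop :=
  (forall n, M (x n)) /\
  forall e : R, 0 < e -> exists N : nat, forall m n : nat,
    (N <= m)%N -> (N <= n)%N -> (dist (x m) (x n) < e%:E)%E.

Definition cauchy_class (x : nat -> E) : set (nat -> E) :=
  [set y | cauchy_seq_in y /\ dist (x n) (y n) @[n --> \oo] --> 0%E].

Definition completion : set (set (nat -> E)) :=
  [set cauchy_class x | x in cauchy_seq_in].

Definition completion_embed (p : E) : set (nat -> E) :=
  cauchy_class (fun=> p).

(* By the triangle inequality the limit does not depend on the representatives
   chosen by [get]. *)
Definition completion_dist (C D : set (nat -> E)) : \bar R :=
  lim (dist ((get C) n) ((get D) n) @[n --> \oo]).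

End Completion.

Section Gaussian.
Context {R : realType} {d : nat}.

(* N(m, S) is the pair (m, S); a * N(m, S) is the pair (a, (m, S)).  Symmetry of
   S and of the tangent matrices is imposed by the carriers and tangent spaces. *)
Local Notation mean_cov := ('cV[R]_d * 'M[R]_d)%type.

Definition spd (S : 'M[R]_d) : Prop :=
  S^T = S /\ forall v : 'cV[R]_d, v != 0 -> 0 < (v^T *m S *m v) 0 0.

Definition gauss1 : set mean_cov := [set mu | spd mu.2].

Definition gauss_tangent : set mean_cov := [set xi | xi.2^T = xi.2].

Definition lyapunov (S X : 'M[R]_d) : 'M[R]_d := S *m X + X *m S.

(* For S positive definite, [lyapunov S] is bijective on all matrices and
   preserves symmetric ones in both directions. *)
Definition lyapunov_inv (S H : 'M[R]_d) : 'M[R]_d :=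
  ((linfun (lyapunov S))^-1)%VF H.

Definition g_BW (mu xi : mean_cov) : R :=
  (xi.1^T *m xi.1) 0 0 + 2^-1 * \tr (xi.2 *m lyapunov_inv mu.2 xi.2).

Definition g_FR (mu xi : mean_cov) : R :=
  (xi.1^T *m invmx mu.2 *m xi.1) 0 0 +
  2^-1 * \tr (invmx mu.2 *m xi.2 *m invmx mu.2 *m xi.2).

Definition parallel_sum (G H : mean_cov -> R) (xi : mean_cov) : R :=
  inf [set G eta + H (xi - eta) | eta in gauss_tangent].

Definition g_par (r : R) (mu : mean_cov) : mean_cov -> R :=
  parallel_sum (g_BW mu) (fun xi => r * g_FR mu xi).

Definition gauss_plus (r : R) : riem_space (R * mean_cov)%type :=
  RiemSpace [set al : (R * mean_cov)%type | 0 < al.1 /\ gauss1 al.2]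
            [set v : (R * mean_cov)%type | gauss_tangent v.2]
            (fun al v : (R * mean_cov)%type => r / al.1 * v.1 ^+ 2 + al.1 * g_par r al.2 v.2).

Definition gauss_shape (r : R) : riem_space mean_cov :=
  RiemSpace gauss1 gauss_tangent (fun mu xi : mean_cov => (4 * r)^-1 * g_par r mu xi).

Definition cone_radius (r : R) (al : R * mean_cov) : R := 2 * Num.sqrt (r * al.1).

Definition to_cone (r : R) (al : R * mean_cov) : R * mean_cov := (cone_radius r al, al.2).

Definition of_cone (r : R) (y : R * mean_cov) : R * mean_cov :=
  (y.1 ^+ 2 / (4 * r), y.2).

End Gaussian.

(* Main.v *)
Require Import Defs.
From HB Require Import structures.
From mathcomp Require Import all_boot all_order all_algebra.
From mathcomp Require Import all_classical all_reals all_analysis.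
From mathcomp Require Import measurable_realfun ring lra.
Set Implicit Arguments.
Unset Strict Implicit.
Unset Printing Implicit Defensive.
Import Order.TTheory GRing.Theory Num.Theory.
Import numFieldNormedType.Exports.
Local Open Scope classical_set_scope.
Local Open Scope ring_scope.

(* In the coordinate rho = 2 sqrt(r a) the metric is d rho^2 + rho^2 h with
   h >= 0, so the speed of any curve is at least |rho'|, and the length of a
   curve is at least the variation of rho; a radial ray attains this bound.
   Non-negativity of h reduces to tr(P H Q H) >= 0 for positive semidefinite
   P, Q and symmetric H.  Choosing eta = xi in the parallel sum bounds h by the
   Bures-Wasserstein metric, which is bounded along a straight segment of
   shapes; hence at mass a two shapes are at distance O(sqrt a).  Therefore
   d(a mu, x_n) --> rho(a) for x_n = (n + 1)^-1 N(0, I), and the class of the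
   Cauchy sequence x_n is the apex. *)

(** * Integrals of non-negative functions *)

(** The parallel sum is an infimum, and how it varies with the shape is not made explicit. What
    enters about it is homogeneity of degree two, non-negativity on tangent vectors, vanishing at
    the zero vector, and the bound by [g_BW]. This shapes the argument: lengths are compared through
    pointwise inequalities between speeds, and the geodesic equation is checked at radial
    velocities, where the shape part of the metric is zero at the base point and at all nearby
    shapes. A second constraint is that shapes are open only inside the subspace of symmetric
    covariances. Hence the velocity of a curve has to be shown symmetric before non-negativity of h
    applies to it, and the metric is differentiated along lines that keep the covariance
    symmetric. *)

(* The integral of a non-negative function is the supremum of the integrals of
   the simple functions below it, so these inequalities need no measurability;
   this spares proving that the speed of a curve is measurable. *)
Section LowerIntegral.
Context {R : realType}.
Notation mu := (@lebesgue_measure R).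
Notation Rm := (measurableTypeR R).
Import HBNNSimple.
Local Open Scope ereal_scope.

Lemma ge0_integral_le_nnsfun (D : set Rm) (f : Rm -> \bar R) (M : \bar R) :
  measurable D -> (forall x, D x -> 0 <= f x) ->
  (forall g : {nnsfun Rm >-> R}, (forall x, D x -> (g x)%:E <= f x) ->
     \int[mu]_(x in D) (g x)%:E <= M) ->
  \int[mu]_(x in D) f x <= M.
Proof.
move=> mD f0 H; rewrite ge0_integralE//; apply: ge_ereal_sup => _ [h /= hf <-].
rewrite -integralT_nnsfun.
(* A non-negative simple function below the extension of [f] by zero vanishes off [D]. *)
rewrite (_ : \int[mu]_x (h x)%:E = \int[mu]_(x in D) (h x)%:E).
  by apply: H => x Dx; have := hf x; rewrite patchE mem_set.
rewrite [RHS]integral_mkcond; apply: eq_integral => x _.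
rewrite patchE; have := hf x; rewrite patchE; case: ifPn => // _ hx.
by apply/eqP; rewrite eq_le hx lee_fin /=; exact: fun_ge0.
Qed.

(** A simple function below [g], cut off to zero on [N], keeps its integral because [N] is null, and
    is then below [f]. The set [N] absorbs the break points and end points of curves, where nothing
    is known about [derive1]. *)
Lemma ge0_le_integral_countable (D N : set Rm) (f g : Rm -> \bar R) :
  measurable D -> countable N ->
  (forall x, D x -> 0 <= f x) -> (forall x, D x -> 0 <= g x) ->
  (forall x, D x -> ~ N x -> g x <= f x) ->
  \int[mu]_(x in D) g x <= \int[mu]_(x in D) f x.
Proof.
move=> mD cN f0 g0 gf; apply: ge0_integral_le_nnsfun => // h hg.
have mN : measurable (~` N) by apply: measurableC; exact: countable_measurable.
rewrite integral_mkcond (_ : \int[mu]_x _ =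
    \int[mu]_x (proj_nnsfun h mD x)%:E); last first.
  apply: eq_integral => x _; rewrite patchE /proj_nnsfun/= !mindicE.
  by case: ifPn => _; rewrite ?mulr1 ?mulr0.
rewrite (_ : \int[mu]_x _ =
    \int[mu]_x (proj_nnsfun (proj_nnsfun h mD) mN x)%:E); last first.
  apply: ge0_ae_eq_integral => //.
  - exact/measurable_EFinP.
  - exact/measurable_EFinP.
  - by move=> x _; rewrite lee_fin.
  - by move=> x _; rewrite lee_fin.
  - exists N; split; [exact: countable_measurable|exact: countable_lebesgue_measure0|].
    move=> x /= H; apply: contrapT => Nx; apply: H => _.
    by rewrite /proj_nnsfun/= !mindicE (mem_set (Nx : (~` N) x)) !mulr1.
rewrite integralT_nnsfun [leRHS]ge0_integralE//.
apply: ereal_sup_ubound; exists (proj_nnsfun (proj_nnsfun h mD) mN) => // x /=.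
rewrite /proj_nnsfun/= !mindicE patchE.
have [xN|xN] := boolP (x \in ~` N); last first.
  rewrite mulr0; case: ifPn => //; rewrite inE; exact: f0.
rewrite mulr1; have [xD|xD] := boolP (x \in D); rewrite ?mulr0 ?mulr1//.
rewrite (le_trans (hg _ (set_mem xD)))// gf//; exact: set_mem.
Qed.

(** This half of additivity bounds the length of a concatenated curve from above. *)
Lemma ge0_integral_setU_le (A B : set Rm) (f : Rm -> \bar R) :
  measurable A -> measurable B -> (forall x, 0 <= f x) -> [disjoint A & B] ->
  \int[mu]_(x in A `|` B) f x <=
    \int[mu]_(x in A) f x + \int[mu]_(x in B) f x.
Proof.
move=> mA mB f0 AB; apply: ge0_integral_le_nnsfun => //.
  exact: measurableU.
move=> g gf; rewrite ge0_integral_setU//.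
- apply: leeD; apply: (@ge0_le_integral_countable _ set0) => //.
  + by move=> x _; rewrite lee_fin.
  + by move=> x xA _; apply: gf; left.
  + by move=> x _; rewrite lee_fin.
  + by move=> x xB _; apply: gf; right.
- apply/measurable_EFinP; exact: measurable_funTS.
- by move=> x _; rewrite lee_fin.
Qed.

Lemma ge0_integral_subset_le (A B : set Rm) (f : Rm -> \bar R) :
  A `<=` B -> (forall x, 0 <= f x) ->
  \int[mu]_(x in A) f x <= \int[mu]_(x in B) f x.
Proof.
move=> AB f0; rewrite [leLHS]integral_mkcond [leRHS]integral_mkcond.
apply: (@ge0_le_integral_countable _ set0) => //.
- by move=> x _; rewrite patchE; case: ifP.
- by move=> x _; rewrite patchE; case: ifP.
move=> x _ _; rewrite !patchE; case: ifPn => [/set_mem/AB/mem_set ->//|_].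
by case: ifP.
Qed.

Let affine (a b : R) : Rm -> Rm := (fun t => a * t + b)%R.

Let measurable_affine a b : measurable_fun [set: _] (affine a b).
Proof. by apply: measurable_funD => //; exact: measurable_funM. Qed.

Let nu (a b : R) : {measure set Rm -> \bar R} :=
  mscale (NngNum (normr_ge0 a))
  (measure_function_pushforward__canonical__measure_function_Measure mu (@measurable_affine a b)).

Lemma lebesgue_measure_affine (a b : R) (A : set Rm) : (a != 0)%R ->
  measurable A -> mu A = nu a b A.
Proof.
move=> a0; apply: lebesgue_measure_unique => _ [[x y]] _ <- /=.
rewrite /nu/= /mscale/= /pushforward.
have ha : (0 < `|a|)%R by rewrite normr_gt0.
case: (ltgtP a 0%R) a0 => // a0 _.
(* For negative [a] the end points are exchanged, so the preimage of an interval open on the left is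
   open on the right; its measure is the same. *)
- rewrite (_ : _ @^-1` _ = `[((y - b) / a)%R, ((x - b) / a)%R[%classic); last first.
    apply/seteqP; split=> t /=; rewrite !in_itv/= /affine.
      by rewrite ler_ndivrMr// ltr_ndivlMr// => /andP[? ?]; apply/andP; split; lra.
    by rewrite ler_ndivrMr// ltr_ndivlMr// => /andP[? ?]; apply/andP; split; lra.
  rewrite !lebesgue_measure_itv/= !lte_fin ltr_nM2r ?invr_lt0// ltrD2r.
  case: ifPn => _; last by rewrite mule0.
  rewrite -!EFinD -EFinM ltr0_norm//; congr EFin; field; exact: ltr0_neq0.
- rewrite (_ : _ @^-1` _ = `]((x - b) / a)%R, ((y - b) / a)%R]%classic); last first.
    apply/seteqP; split=> t /=; rewrite !in_itv/= /affine.
      by rewrite ler_pdivlMr// ltr_pdivrMr// => /andP[? ?]; apply/andP; split; lra.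
    by rewrite ler_pdivlMr// ltr_pdivrMr// => /andP[? ?]; apply/andP; split; lra.
  rewrite !lebesgue_measure_itv/= !lte_fin ltr_pM2r ?invr_gt0// ltrD2r.
  case: ifPn => _; last by rewrite mule0.
  rewrite -!EFinD -EFinM gtr0_norm//; congr EFin; field; exact: lt0r_neq0.
Qed.

(** Change of variables for reversed and concatenated curves. A simple function below [g] is carried
    to [D] by the inverse map [psi]; there, divided by |a|, it lies below [f] off the image of
    [N]. *)
Lemma ge0_le_integral_affine (a b : R) (D N : set Rm) (f g : Rm -> \bar R) :
  (a != 0)%R -> measurable D -> countable N ->
  (forall x, D x -> 0 <= f x) ->
  (forall x, D (a * x + b)%R -> 0 <= g x) ->
  (forall x, D (a * x + b)%R -> ~ N x -> g x <= `|a|%:E * f (a * x + b)%R) ->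
  \int[mu]_(x in [set x | D (a * x + b)%R]) g x <= \int[mu]_(x in D) f x.
Proof.
move=> a0 mD cN f0 g0 gf.
have mphiD : measurable (affine a b @^-1` D).
  by rewrite -[X in measurable X]setTI; apply: measurable_affine.
apply: ge0_integral_le_nnsfun => // h hg.
pose psi := affine a^-1 (- (b / a))%R.
have phiK t : psi (affine a b t) = t by rewrite /psi /affine; field.
have psiK t : affine a b (psi t) = t by rewrite /psi /affine; field.
have mh : measurable_fun [set: Rm] (EFin \o (h \o psi)).
  by apply/measurable_EFinP; apply: measurableT_comp => //; exact: measurable_affine.
have absa_gt0 : (0 < `|a|)%R by rewrite normr_gt0.
have -> : \int[mu]_(x in affine a b @^-1` D) (h x)%:E =
  (`|a|^-1)%:E * \int[mu]_(x in D) (h (psi x))%:E.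
  have -> : \int[mu]_(x in D) (h (psi x))%:E = \int[nu a b]_(x in D) (h (psi x))%:E.
    by apply: eq_measure_integral => A mA _; exact: lebesgue_measure_affine.
  rewrite ge0_integral_mscale//=; last 2 first.
  - exact: measurable_funTS.
  - by move=> x _; rewrite lee_fin.
  rewrite ge0_integral_pushforward//; last 2 first.
  - exact: measurable_funTS.
  - by move=> x _; rewrite lee_fin.
  rewrite muleA -EFinM mulVf ?mul1e ?normr_eq0//.
  by apply: eq_integral => x _ /=; rewrite phiK.
rewrite -ge0_integralZl_EFin//; last 2 first.
- by move=> x _; rewrite lee_fin.
- exact: measurable_funTS.
apply: (@ge0_le_integral_countable _ (affine a b @` N)) => //.
- exact: card_le_trans (card_image_le _ _) cN.
- by move=> x _; rewrite -EFinM lee_fin mulr_ge0// invr_ge0.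
- move=> x Dx Nx.
  have Dp : D (a * psi x + b)%R by rewrite -[X in D X]/(affine a b (psi x)) psiK.
  have Np : ~ N (psi x) by move=> Np; apply: Nx; exists (psi x).
  have := le_trans (hg _ Dp) (gf _ Dp Np).
  rewrite -[X in f X]/(affine a b (psi x)) psiK => H.
  by rewrite lee_pdivrMl// muleC.
Qed.

End LowerIntegral.

(** * Quadratic forms and the Lyapunov operator *)

Section QuadraticForms.
Context {R : realFieldType} {d : nat}.
Implicit Types (A P Q H S : 'M[R]_d) (u v w : 'cV[R]_d).

Definition bform A u v : R := (u^T *m A *m v) 0 0.

Let mx_subE m n (M N : 'M[R]_(m, n)) i j : (M - N) i j = M i j - N i j.
Proof. by rewrite !mxE. Qed.

Let mx_scaleE m n (M : 'M[R]_(m, n)) c i j : (c *: M) i j = c * M i j.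
Proof. by rewrite mxE. Qed.

Lemma bform_subZ A u w (c : R) :
  bform A (u - c *: w) (u - c *: w) =
  bform A u u - c * (bform A u w + bform A w u) + c ^+ 2 * bform A w w.
Proof.
rewrite /bform (_ : (_ - _)^T = u^T - c *: w^T); last first.
  by apply/matrixP => i j; rewrite !mxE.
rewrite !mulmxBl !mulmxBr -!scalemxAl -!scalemxAr.
by rewrite !(mx_subE, mx_scaleE); ring.
Qed.

Lemma bformC A u v : A^T = A -> bform A u v = bform A v u.
Proof.
move=> As; rewrite /bform -[in LHS](trmxK (u^T *m A *m v)) [in LHS]mxE.
by rewrite !trmx_mul trmxK As mulmxA.
Qed.

Lemma bform_delta A i j : bform A (delta_mx i 0) (delta_mx j 0) = A i j.
Proof. by rewrite /bform trmx_delta -rowE -colE !mxE. Qed.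

Lemma bform_delta_l A i v : bform A (delta_mx i 0) v = (A *m v) i 0.
Proof. by rewrite /bform trmx_delta -mulmxA -rowE mxE. Qed.

Lemma dotE v : (v^T *m v) 0 0 = \sum_i v i 0 ^+ 2.
Proof. by rewrite mxE; apply: eq_bigr => i _; rewrite mxE expr2. Qed.

Lemma dot_ge0 v : 0 <= (v^T *m v) 0 0.
Proof. by rewrite dotE; apply: sumr_ge0 => i _; exact: sqr_ge0. Qed.

Lemma dot_gt0 v : v != 0 -> 0 < (v^T *m v) 0 0.
Proof.
move=> v0; rewrite lt_def dot_ge0 andbT dotE.
apply: contra v0; rewrite psumr_eq0; last by move=> i _; exact: sqr_ge0.
move=> /allP H; apply/eqP/matrixP => i j; rewrite (ord1 j) mxE.
by apply/eqP; rewrite -sqrf_eq0; apply: H; rewrite mem_index_enum.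
Qed.

(* Peeling off the rank-one part q q^T / Q_ii, with q the i-th column of Q,
   leaves a positive semidefinite matrix with one more zero on the diagonal. *)
Lemma mxtrace_psd_ge0 P Q H :
  (forall v, 0 <= bform P v v) -> Q^T = Q -> (forall v, 0 <= bform Q v v) ->
  H^T = H -> 0 <= \tr (P *m H *m Q *m H).
Proof.
move=> P0 + + Hs.
have [n] := ubnP #|[pred i | Q i i != 0]|; elim: n => // n IH in Q *.
move=> leQ Qs Q0.
have [/existsP[i Qii]|/existsPn Qd] := boolP [exists i, Q i i != 0]; last first.
  suff -> : Q = 0 by rewrite mulmx0 mul0mx mxtrace0.
  apply/matrixP => i j; rewrite mxE.
  (* With a zero diagonal, the form at e_i - c e_j is linear in c; being non-negative for c = 1 and
     c = -1, it vanishes. *)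
  have E c : 0 <= - c * (Q i j *+ 2).
    have := Q0 (delta_mx i 0 - c *: delta_mx j 0).
    rewrite bform_subZ (bformC _ _ Qs) !bform_delta.
    have /negPn/eqP -> := Qd i; have /negPn/eqP -> := Qd j.
    rewrite (_ : Q j i = Q i j); last by rewrite -[in LHS]Qs mxE.
    by rewrite mulr0 addr0 sub0r -mulNr -mulr2n.
  have := E 1; have := E (-1); lra.
have Qip : 0 < Q i i by rewrite lt_def Qii -bform_delta Q0.
pose q := col i Q; pose k := (Q i i)^-1.
have k0 : 0 < k by rewrite invr_gt0.
pose Q' := Q - k *: (q *m q^T).
have Q's : Q'^T = Q'.
  by rewrite /Q' linearB /= linearZ /= trmx_mul trmxK Qs.
have qv v : (q^T *m v) 0 0 = bform Q (delta_mx i 0) v.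
  by rewrite bform_delta_l /q tr_col Qs -row_mul mxE.
have Q'E v : bform Q' v v = bform Q v v - k * bform Q (delta_mx i 0) v ^+ 2.
  rewrite -qv /bform /Q' mulmxBr mulmxBl -scalemxAr -scalemxAl mx_subE mx_scaleE; congr (_ - k * _).
  rewrite (_ : _ *m _ *m v = (v^T *m q) *m (q^T *m v)); last by rewrite !mulmxA.
  rewrite [LHS]mxE big_ord1 expr2; congr (_ * _).
  by rewrite -[in LHS](trmxK (v^T *m q)) [in LHS]mxE trmx_mul trmxK.
(* The value of Q' at v is the minimum of Q on the line v + R e_i, attained at the vector tested
   here. *)
have Q'0 v : 0 <= bform Q' v v.
  have := Q0 (v - (k * bform Q (delta_mx i 0) v) *: delta_mx i 0).
  rewrite bform_subZ bform_delta (bformC v _ Qs) Q'E.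
  suff -> : (k * bform Q (delta_mx i 0) v) ^+ 2 * Q i i = k * bform Q (delta_mx i 0) v ^+ 2 by lra.
  by rewrite /k; field.
have -> : \tr (P *m H *m Q *m H) = \tr (P *m H *m Q' *m H) + k * bform P (H *m q) (H *m q).
  rewrite (_ : Q = Q' + k *: (q *m q^T)); last by rewrite subrK.
  rewrite mulmxDr mulmxDl mxtraceD; congr (_ + _).
  rewrite -scalemxAr -scalemxAl mxtraceZ; congr (_ * _).
  rewrite (_ : _ *m H = (P *m H *m q) *m (q^T *m H)); last by rewrite !mulmxA.
  by rewrite mxtrace_mulC /bform trmx_mul Hs trace_mx11 !mulmxA.
apply: addr_ge0; last by rewrite mulr_ge0// ltW.
apply: IH => //; move: leQ; rewrite ltnS; apply: leq_trans.
(* The induction is on the number of non-zero diagonal entries: zero entries stay zero because 0 <=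
   Q'_jj <= Q_jj, and the i-th one becomes zero. *)
apply: proper_card; apply/properP; split.
  apply/fintype.subsetP => j; rewrite !inE; apply: contra => /eqP Qj.
  rewrite eq_le -{2}bform_delta Q'0 andbT -bform_delta Q'E bform_delta Qj sub0r.
  by rewrite oppr_le0 mulr_ge0 ?sqr_ge0// ltW.
exists i; first by rewrite inE.
by rewrite inE negbK -bform_delta Q'E bform_delta /k; apply/eqP; field.
Qed.

Lemma bform_bound A : exists2 C : R, 0 < C &
  forall v, `|bform A v v| <= C * (v^T *m v) 0 0.
Proof.
(* The summand 1 keeps the constant positive when A = 0, so that it can be divided by. *)
exists (1 + \sum_i \sum_j `|A i j|).
  rewrite ltr_pwDl//; apply: sumr_ge0 => i _; exact: sumr_ge0.
move=> v; set q := (v^T *m v) 0 0.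
have vq i : v i 0 ^+ 2 <= q.
  rewrite /q dotE (bigD1 i)//= lerDl; apply: sumr_ge0 => j _; exact: sqr_ge0.
have vv i j : `|v i 0| * `|v j 0| <= q.
  have := vq i; have := vq j.
  rewrite -(real_normK (num_real (v i 0))) -(real_normK (num_real (v j 0))).
  by have := sqr_ge0 (`|v i 0| - `|v j 0|); rewrite sqrrB; lra.
have -> : bform A v v = \sum_i \sum_j v i 0 * A i j * v j 0.
  rewrite /bform -mulmxA mxE; apply: eq_bigr => i _; rewrite !mxE mulr_sumr.
  by apply: eq_bigr => j _; rewrite mulrA.
have q0 : 0 <= q by exact: dot_ge0.
rewrite mulrDl mul1r (le_trans (ler_norm_sum _ _ _))//
  (@le_trans _ _ (\sum_i \sum_j `|A i j| * q))//.
  apply: ler_sum => i _; rewrite (le_trans (ler_norm_sum _ _ _))//.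
  apply: ler_sum => j _; rewrite !normrM mulrAC mulrC ler_wpM2l//.
rewrite mulr_suml; under [X in _ <= _ + X]eq_bigr do rewrite mulr_suml.
by rewrite lerDr.
Qed.

End QuadraticForms.

(** * Positive definite matrices and the Lyapunov equation *)

Section Spd.
Context {R : realType} {d : nat}.
Implicit Types (S H X : 'M[R]_d) (v : 'cV[R]_d).

Lemma spd_unitmx S : spd S -> S \in unitmx.
Proof.
move=> [Ss Sp]; rewrite -row_free_unit -kermx_eq0; apply/negPn/negP => K0.
have [i Ki] : exists i, row i (kermx S) != 0.
  apply/existsP; apply: contraNT K0; rewrite negb_exists => /forallP K.
  by apply/eqP/row_matrixP => i; rewrite row0; apply/eqP/negPn.
have vS : row i (kermx S) *m S = 0 by rewrite -row_mul mulmx_ker row0.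
have /Sp : (row i (kermx S))^T != 0 by rewrite trmx_eq0.
by rewrite trmxK vS mul0mx mxE ltxx.
Qed.

Lemma spd_sym S : spd S -> S^T = S. Proof. by case. Qed.

Lemma spd_ge0 S v : spd S -> 0 <= bform S v v.
Proof.
move=> [_ Sp]; have [->|/Sp/ltW//] := eqVneq v 0.
by rewrite /bform mulmx0 mxE.
Qed.

Lemma invmx_spd S : spd S -> spd (invmx S).
Proof.
move=> Sp; have Su := spd_unitmx Sp; split.
  by rewrite trmx_inv (spd_sym Sp).
move=> v v0; have : invmx S *m v != 0.
  by apply: contra v0 => /eqP /(congr1 (mulmx S)); rewrite mulKVmx// mulmx0 => ->.
case: (Sp) => _ /[apply]; rewrite trmx_mul trmx_inv (spd_sym Sp).
by rewrite !mulmxA mulmxKV.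
Qed.

(* With w = S^-1 v, expand 0 <= (v - w / C)^T S (v - w / C), where C bounds
   the quadratic form of S^-1. *)
Lemma spd_coercive S : spd S -> exists2 l : R, 0 < l &
  forall v, l * (v^T *m v) 0 0 <= bform S v v.
Proof.
move=> Sp; have Su := spd_unitmx Sp.
have [C C0 hC] := bform_bound (invmx S).
exists C^-1; first by rewrite invr_gt0.
move=> v; set q := (v^T *m v) 0 0.
have := spd_ge0 (v - C^-1 *: (invmx S *m v)) Sp.
rewrite bform_subZ.
have -> : bform S v (invmx S *m v) = q by rewrite /bform mulmxA mulmxK.
have -> : bform S (invmx S *m v) v = q.
  by rewrite /bform trmx_mul trmx_inv (spd_sym Sp) mulmxKV.
have -> : bform S (invmx S *m v) (invmx S *m v) = bform (invmx S) v v.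
  by rewrite /bform trmx_mul trmx_inv (spd_sym Sp) mulmxKV// mulmxA.
have := ler_norm (bform (invmx S) v v); have := hC v; rewrite -/q => h1 h2.
have h3 : C^-1 ^+ 2 * bform (invmx S) v v <= C^-1 * q.
  rewrite expr2 -mulrA ler_wpM2l ?invr_ge0 ?(ltW C0)//.
  by rewrite ler_pdivrMl//; exact: le_trans h1.
by lra.
Qed.

Lemma mxtrace_form (M X : 'M[R]_d) :
  \tr (X^T *m M *m X) = \sum_j bform M (col j X) (col j X).
Proof.
rewrite /mxtrace; apply: eq_bigr => j _.
by rewrite -bform_delta /bform !colE trmx_mul !mulmxA.
Qed.

Lemma mxtrace_form_ge0 S X : spd S -> 0 <= \tr (X^T *m S *m X).
Proof. by move=> Sp; rewrite mxtrace_form sumr_ge0// => j _; exact: spd_ge0. Qed.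

Lemma mxtrace_sqrE X :
  \tr (X^T *m X) = \sum_j ((col j X)^T *m col j X) 0 0.
Proof.
rewrite -[X in X *m _](mulmx1 X^T) mxtrace_form.
by apply: eq_bigr => j _; rewrite /bform mulmx1.
Qed.

Lemma mxtrace_sqr_ge0 X : 0 <= \tr (X^T *m X).
Proof. by rewrite mxtrace_sqrE sumr_ge0// => j _; exact: dot_ge0. Qed.

Lemma mxtrace_form_coercive S X l :
  (forall v, l * (v^T *m v) 0 0 <= bform S v v) ->
  l * \tr (X^T *m X) <= \tr (X^T *m S *m X).
Proof. by move=> Sl; rewrite mxtrace_form mxtrace_sqrE mulr_sumr ler_sum. Qed.

Lemma mxtrace_sqr_eq0 X : \tr (X^T *m X) = 0 -> X = 0.
Proof.
move=> /eqP; rewrite mxtrace_sqrE psumr_eq0; last by move=> j _; exact: dot_ge0.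
move=> /allP H; apply/matrixP => i j; rewrite mxE.
have [/matrixP/(_ i 0)|/dot_gt0] := eqVneq (col j X) 0; first by rewrite !mxE.
by have /eqP -> := H j (mem_index_enum j); rewrite ltxx.
Qed.

Lemma lyapunov_is_linear S : linear (lyapunov S).
Proof.
move=> a X Y; rewrite /lyapunov mulmxDr mulmxDl -scalemxAr -scalemxAl.
by rewrite scalerDr addrACA.
Qed.

HB.instance Definition _ S :=
  GRing.isLinear.Build R 'M[R]_d 'M[R]_d _ (lyapunov S) (lyapunov_is_linear S).

(** Pairing the equation with X gives tr(X^T S X) + tr(X^T X S) = 0; the second trace is
    non-negative and the first is at least l tr(X^T X). *)
Lemma lyapunov_inj S X : spd S -> lyapunov S X = 0 -> X = 0.
Proof.
move=> Sp LX; have [l l0 hl] := spd_coercive Sp.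
apply: mxtrace_sqr_eq0; apply/eqP; rewrite eq_le mxtrace_sqr_ge0 andbT.
have : \tr (X^T *m lyapunov S X) = 0 by rewrite LX mulmx0 mxtrace0.
rewrite /lyapunov mulmxDr mxtraceD !mulmxA => E.
have h1 := mxtrace_form_coercive X hl.
have := mxtrace_form_ge0 X^T Sp; rewrite trmxK -mulmxA mxtrace_mulC => h2.
have {E h1 h2} : l * \tr (X^T *m X) <= 0.
  have : \tr (X^T *m X *m S) = \tr (S *m X^T *m X) by rewrite -[in RHS]mulmxA mxtrace_mulC.
  by lra.
by rewrite pmulr_rle0.
Qed.

Lemma lyapunov_invK S : spd S -> cancel (lyapunov_inv S) (lyapunov S).
Proof.
move=> Sp H; rewrite /lyapunov_inv -[LHS](lfunE (lyapunov S)).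
(* An injective endomorphism of a finite-dimensional space is onto, so a trivial kernel makes the
   inverse a right inverse. *)
apply: lker0_lfunVK.
apply/eqP/vspaceP => X; rewrite memv_ker memv0 lfunE.
by apply/eqP/eqP => [/(lyapunov_inj Sp)//|->]; rewrite linear0.
Qed.

(** The transpose of the solution solves the same equation, whose solution is unique. *)
Lemma lyapunov_inv_sym S H : spd S -> H^T = H ->
  (lyapunov_inv S H)^T = lyapunov_inv S H.
Proof.
move=> Sp Hs; apply/eqP; rewrite -subr_eq0; apply/eqP/(lyapunov_inj Sp).
rewrite linearB /= lyapunov_invK//.
have -> : lyapunov S (lyapunov_inv S H)^T = (lyapunov S (lyapunov_inv S H))^T.
  by rewrite /lyapunov linearD /= !trmx_mul (spd_sym Sp) addrC.
by rewrite lyapunov_invK// Hs subrr.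
Qed.

Lemma mxtrace_lyapunov_inv S H : spd S -> H^T = H ->
  let X := lyapunov_inv S H in \tr (H *m X) = 2 * \tr (X^T *m S *m X).
Proof.
move=> Sp Hs X; have Xs : X^T = X by exact: lyapunov_inv_sym.
rewrite Xs -{1}(lyapunov_invK Sp H) -/X /lyapunov mulmxDl mxtraceD.
by rewrite (mxtrace_mulC (S *m X)) mulmxA mulr_natl mulr2n.
Qed.

(** Expand 0 <= |H - 2 l X|^2 in the Frobenius norm and use 2 l |X|^2 <= tr(H X), which follows from
    coercivity. The bound depends on S through l alone, hence is uniform along a segment of
    covariances. *)
Lemma mxtrace_lyapunov_inv_le S H l : spd S -> H^T = H -> 0 < l ->
  (forall v, l * (v^T *m v) 0 0 <= bform S v v) ->
  \tr (H *m lyapunov_inv S H) <= (2 * l)^-1 * \tr (H^T *m H).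
Proof.
move=> Sp Hs l0 hl; set X := lyapunov_inv S H.
have Xs : X^T = X by exact: lyapunov_inv_sym.
have E := mxtrace_lyapunov_inv Sp Hs; rewrite /= -/X in E.
have h1 := mxtrace_form_coercive X hl.
have := mxtrace_sqr_ge0 (H - (2 * l) *: X).
have -> : (H - (2 * l) *: X)^T = H - (2 * l) *: X.
  by apply/matrixP => i j; rewrite !mxE -{1}Hs -{1}Xs !mxE.
rewrite mulmxBl !mulmxBr -!scalemxAl -!scalemxAr !raddfB /= !mxtraceZ (mxtrace_mulC X H).
rewrite ler_pdivlMl; last by lra.
rewrite Hs; rewrite Xs in h1 E *. by nra.
Qed.
End Spd.

(** * The parallel sum metric on shapes *)

(** A set without infimum has [inf] equal to 0 by convention, and scaling by c > 0 preserves having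
    one, so the identity holds for every set. This makes the metric homogeneous at every point of
    the ambient space, as [metricZ] below demands. *)
Lemma infZ (R : realType) (c : R) (A : set R) : 0 < c ->
  inf [set c * x | x in A] = c * inf A.
Proof.
have half (k : R) (B : set R) : 0 < k -> has_inf B ->
    has_inf [set k * x | x in B] /\ k * inf B <= inf [set k * x | x in B].
  move=> k0 [[b Bb] hB].
  have lb : lbound [set k * x | x in B] (k * inf B).
    by move=> _ [x Bx <-]; rewrite ler_pM2l//; exact: ge_inf.
  have ne : [set k * x | x in B] !=set0 by exists (k * b); exists b.
  by split; [split=> //; exists (k * inf B)|exact: lb_le_inf].
move=> c0; have ci : 0 < c^-1 by rewrite invr_gt0.
have cE : [set c^-1 * y | y in [set c * x | x in A]] = A.
  apply/seteqP; split=> [_ [_ [x Ax <-] <-]|x Ax]; first by rewrite mulKf// gt_eqF.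
  by exists (c * x); [exists x|rewrite mulKf// gt_eqF].
have [hA|nA] := pselect (has_inf A).
  have [hcA le1] := half _ _ c0 hA.
  have [_ le2] := half _ _ ci hcA; rewrite cE in le2.
  by apply/eqP; rewrite eq_le le1 andbT -ler_pdivrMl.
have ncA : ~ has_inf [set c * x | x in A].
  by move=> /(half _ _ ci)[+ _]; rewrite cE.
by rewrite !inf_out// mulr0.
Qed.

Section GaussianForms.
Context {R : realType} {d : nat}.
Local Notation mean_cov := ('cV[R]_d * 'M[R]_d)%type.
Implicit Types (mu xi eta : mean_cov) (S H X : 'M[R]_d) (v : 'cV[R]_d).

Let trmxZ m n (k : R) (M : 'M[R]_(m, n)) : (k *: M)^T = k *: M^T.
Proof. by apply/matrixP => i j; rewrite !mxE. Qed.

Let mx_scaleE m n (M : 'M[R]_(m, n)) c i j : (c *: M) i j = c * M i j.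
Proof. by rewrite mxE. Qed.

Lemma g_BWZ mu xi (k : R) : g_BW mu (k *: xi) = k ^+ 2 * g_BW mu xi.
Proof.
rewrite /g_BW /= (_ : lyapunov_inv _ (k *: _) = k *: lyapunov_inv mu.2 xi.2); last first.
  by rewrite /lyapunov_inv linearZ.
by rewrite trmxZ -!scalemxAl -!scalemxAr !mxtraceZ !mx_scaleE; ring.
Qed.

Lemma g_FRZ mu xi (k : R) : g_FR mu (k *: xi) = k ^+ 2 * g_FR mu xi.
Proof.
rewrite /g_FR /= trmxZ -!scalemxAr -!scalemxAl !mxtraceZ !mx_scaleE.
ring.
Qed.

Lemma g_BW_ge0 mu xi : gauss1 mu -> gauss_tangent xi -> 0 <= g_BW mu xi.
Proof.
move=> Sp xs; apply: addr_ge0; first exact: dot_ge0.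
rewrite mxtrace_lyapunov_inv// !mulr_ge0// ?invr_ge0//.
exact: mxtrace_form_ge0.
Qed.

Lemma g_FR_ge0 mu xi : gauss1 mu -> gauss_tangent xi -> 0 <= g_FR mu xi.
Proof.
move=> Sp xs; have Si := invmx_spd Sp.
apply: addr_ge0; first exact: spd_ge0.
rewrite mulr_ge0 ?invr_ge0// mxtrace_psd_ge0//.
- by move=> v; exact: spd_ge0.
- exact: spd_sym.
- by move=> v; exact: spd_ge0.
Qed.

Lemma gauss_tangentB xi eta :
  gauss_tangent xi -> gauss_tangent eta -> gauss_tangent (xi - eta).
Proof. by rewrite /gauss_tangent /= linearB /= => -> ->. Qed.

Lemma gauss_tangentZ xi (k : R) : gauss_tangent xi -> gauss_tangent (k *: xi).
Proof. by rewrite /gauss_tangent /= linearZ /= => ->. Qed.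

Lemma gauss_tangent0 : gauss_tangent (0 : mean_cov).
Proof. by rewrite /gauss_tangent /= linear0. Qed.

Variable r : R.
Hypothesis r0 : 0 < r.

Lemma g_parZ mu xi (k : R) : k != 0 -> g_par r mu (k *: xi) = k ^+ 2 * g_par r mu xi.
Proof.
move=> k0; rewrite /g_par /parallel_sum -infZ ?exprn_even_gt0//.
congr inf; apply/seteqP; split => [_ [eta et <-]|_ [_ [eta et <-] <-]].
  have [e es E] : exists2 e, gauss_tangent e & eta = k *: e.
    exists (k^-1 *: eta); first exact: gauss_tangentZ.
    by rewrite scalerA mulfV// scale1r.
  exists (g_BW mu e + r * g_FR mu (xi - e)); first by exists e.
  by rewrite E -scalerBr g_BWZ g_FRZ; ring.
exists (k *: eta); first exact: gauss_tangentZ.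
by rewrite -scalerBr g_BWZ g_FRZ; ring.
Qed.

Lemma g_parN mu xi : g_par r mu (- xi) = g_par r mu xi.
Proof. by rewrite -scaleN1r g_parZ ?sqrrN ?expr1n ?mul1r// oppr_eq0 oner_eq0. Qed.

Lemma g_par_set_ge0 mu xi : gauss1 mu -> gauss_tangent xi ->
  lbound [set g_BW mu eta + r * g_FR mu (xi - eta) | eta in gauss_tangent] 0.
Proof.
move=> Sp xs _ [eta es <-]; apply: addr_ge0; first exact: g_BW_ge0.
by rewrite mulr_ge0 ?(ltW r0)// g_FR_ge0//; exact: gauss_tangentB.
Qed.

Lemma g_par_ge0 mu xi : gauss1 mu -> gauss_tangent xi -> 0 <= g_par r mu xi.
Proof.
move=> Sp xs; apply: lb_le_inf; last exact: g_par_set_ge0.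
by eexists; exists 0 => //; exact: gauss_tangent0.
Qed.

Lemma g_par_le_BW mu xi : gauss1 mu -> gauss_tangent xi ->
  g_par r mu xi <= g_BW mu xi.
Proof.
move=> Sp xs; apply: ge_inf; first by exists 0; exact: g_par_set_ge0.
exists xi => //; rewrite subrr -[X in g_FR _ X](scale0r 0) g_FRZ.
by rewrite expr0n/= mul0r mulr0 addr0.
Qed.

Lemma g_par0 mu : gauss1 mu -> g_par r mu 0 = 0.
Proof.
move=> Sp; apply/eqP; rewrite eq_le g_par_ge0 ?andbT//; last exact: gauss_tangent0.
rewrite (le_trans (g_par_le_BW Sp gauss_tangent0))//.
by rewrite -[X in g_BW _ X](scale0r 0) g_BWZ expr0n/= mul0r.
Qed.

Lemma spd1 : spd (1%:M : 'M[R]_d).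
Proof. by split; [rewrite trmx1|move=> v v0; rewrite mulmx1 dot_gt0]. Qed.

Lemma bform_addZ S H v (t : R) : bform (S + t *: H) v v = bform S v v + t * bform H v v.
Proof. by rewrite /bform mulmxDr mulmxDl -scalemxAr -scalemxAl !mxE. Qed.

(** The covariance stays coercive as long as |t| C < l, where l is its coercivity constant and C
    bounds the form of the tangent matrix. The geodesic equation differentiates the metric along
    such lines. *)
Lemma gauss1_near mu xi : gauss1 mu -> gauss_tangent xi ->
  \forall t \near (0 : R), gauss1 (mu + t *: xi).
Proof.
move=> Sp xs; have [l l0 hl] := spd_coercive Sp; have [C C0 hC] := bform_bound xi.2.
have lC : 0 < l / C by rewrite divr_gt0.
near=> t.
have tl : `|t| * C < l.
  by rewrite -ltr_pdivlMr//; near: t; exact: nbhs0_lt.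
split; first by rewrite /= linearD linearZ /= (spd_sym Sp) xs.
move=> v /dot_gt0 v0; rewrite -/(bform _ v v) bform_addZ.
have := hl v; have := hC v; set q := (_ *m _) 0 0 in v0 *; move=> h1 h2.
have : `|t * bform xi.2 v v| < l * q.
  rewrite normrM; apply: (le_lt_trans (ler_wpM2l _ h1)) => //.
  by rewrite mulrA ltr_pM2r.
by rewrite ltr_norml => /andP[h3 _]; lra.
Unshelve. all: by end_near. Qed.

Lemma gauss_segment mu nu : gauss1 mu -> gauss1 nu ->
  exists C : R, forall t, 0 <= t <= 1 ->
    gauss1 (mu + t *: (nu - mu)) /\
    g_par r (mu + t *: (nu - mu)) (nu - mu) <= C.
Proof.
move=> Sm Sn; set xi := nu - mu.
have xs : gauss_tangent xi by apply: gauss_tangentB; exact: spd_sym.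
have [l l0 hl] := spd_coercive Sm; have [l' l'0 hl'] := spd_coercive Sn.
(* The form at time t is a convex combination of the two end forms, so the smaller coercivity
   constant serves the whole segment and gives a bound free of t. *)
pose k := Num.min l l'; have k0 : 0 < k by rewrite lt_min l0.
exists ((xi.1^T *m xi.1) 0 0 + 2^-1 * ((2 * k)^-1 * \tr (xi.2^T *m xi.2))).
move=> t /andP[t0 t1].
have hk v : k * (v^T *m v) 0 0 <= bform (mu + t *: xi).2 v v.
  rewrite /= (_ : _ + _ = (1 - t) *: mu.2 + t *: nu.2); last first.
    by rewrite /xi /= scalerBr scalerBl scale1r addrA addrAC.
  rewrite bform_addZ -[X in bform X v v]add0r bform_addZ.
  rewrite [X in X + _ + _](_ : _ = 0) ?add0r; last by rewrite /bform mulmx0 mul0mx mxE.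
  have q0 := dot_ge0 v; set q := (_ *m _) 0 0 in q0 *.
  have h1 : k * q <= bform mu.2 v v by rewrite (le_trans _ (hl v))// ler_wpM2r// ge_min lexx.
  have h2 : k * q <= bform nu.2 v v by rewrite (le_trans _ (hl' v))// ler_wpM2r// ge_min lexx orbT.
  have : (1 - t) * (k * q) <= (1 - t) * bform mu.2 v v by rewrite ler_wpM2l// subr_ge0.
  have : t * (k * q) <= t * bform nu.2 v v by rewrite ler_wpM2l.
  by lra.
have St : gauss1 (mu + t *: xi).
  split; first by rewrite /= linearD linearZ /= (spd_sym Sm) xs.
  by move=> v /dot_gt0 v0; rewrite (lt_le_trans _ (hk v))// mulr_gt0.
split=> //; rewrite (le_trans (g_par_le_BW St xs))//.
by rewrite lerD2l ler_wpM2l ?invr_ge0// mxtrace_lyapunov_inv_le.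
Qed.

End GaussianForms.

(** * Metric completion *)

Section CompletionTheory.
Context {R : realType} {E : pointedType}.
(** Distances are extended reals, whereas limits and triangle inequalities are easier in R: [D] is
    the real-valued version of [dist] on [M]. *)
Variables (M : set E) (dist : E -> E -> \bar R) (D : E -> E -> R).
Hypothesis distE : forall x y, M x -> M y -> dist x y = (D x y)%:E.
Hypothesis D_refl : forall x, M x -> D x x = 0.
Hypothesis D_sym : forall x y, M x -> M y -> D x y = D y x.
Hypothesis D_triangle : forall x y z, M x -> M y -> M z ->
  D x z <= D x y + D y z.

Let cvg_distE (x y : nat -> E) (l : R) :
  (forall n, M (x n)) -> (forall n, M (y n)) ->
  dist (x n) (y n) @[n --> \oo] --> l%:E <-> D (x n) (y n) @[n --> \oo] --> l.
Proof.
move=> Mx My.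
rewrite (_ : (fun n => dist (x n) (y n)) = EFin \o (fun n => D (x n) (y n))).
  by split=> [/fine_cvgP[_]//|]; apply: cvg_EFin; exact: nearW.
by apply/funext => n /=; rewrite distE.
Qed.

Let D_refl_cvg (x : nat -> E) : (forall n, M (x n)) ->
  D (x n) (x n) @[n --> \oo] --> (0 : R).
Proof.
move=> Mx; rewrite (_ : (fun n => D (x n) (x n)) = cst 0); first exact: cvg_cst.
by apply/funext => n; exact: D_refl.
Qed.

Lemma cauchy_classP (x y : nat -> E) : cauchy_seq_in M dist x ->
  cauchy_class M dist x y <->
  cauchy_seq_in M dist y /\ D (x n) (y n) @[n --> \oo] --> (0 : R).
Proof.
move=> [Mx _]; split=> -[cy h]; split=> //.
  exact: (cvg_distE _ Mx cy.1).1.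
exact: (cvg_distE _ Mx cy.1).2.
Qed.

Lemma cauchy_class_refl (x : nat -> E) :
  cauchy_seq_in M dist x -> cauchy_class M dist x x.
Proof.
move=> cx; apply/(cauchy_classP _ cx); split=> //.
exact: D_refl_cvg cx.1.
Qed.

Lemma D_quadrangle x y x' y' : M x -> M y -> M x' -> M y' ->
  `|D x' y' - D x y| <= D x x' + D y y'.
Proof.
move=> Mx My Mx' My'.
have h1 := D_triangle Mx' Mx My'; have h2 := D_triangle Mx My My'.
have h3 := D_triangle Mx Mx' My; have h4 := D_triangle Mx' My' My.
rewrite (D_sym Mx' Mx) in h1; rewrite (D_sym My' My) in h4.
by rewrite ler_norml; apply/andP; split; lra.
Qed.

(** The four-point inequality squeezes the difference of the two sequences of distances to 0. This
    is why the distance of two classes may be computed on any representatives. *)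
Lemma cvg_D_class (x y x' y' : nat -> E) (l : R) :
  (forall n, M (x n)) -> (forall n, M (y n)) ->
  (forall n, M (x' n)) -> (forall n, M (y' n)) ->
  D (x n) (x' n) @[n --> \oo] --> (0 : R) ->
  D (y n) (y' n) @[n --> \oo] --> (0 : R) ->
  D (x n) (y n) @[n --> \oo] --> l -> D (x' n) (y' n) @[n --> \oo] --> l.
Proof.
move=> Mx My Mx' My' hx hy hl.
have h0 : (D (x' n) (y' n) - D (x n) (y n)) @[n --> \oo] --> (0 : R).
  apply/norm_cvg0P; apply: (@squeeze_cvgr _ _ _ _ (cst 0)
    (fun n => D (x n) (x' n) + D (y n) (y' n))).
  - by apply: nearW => n; rewrite normr_ge0 D_quadrangle.
  - exact: cvg_cst.
  - by rewrite -[X in _ --> X](addr0 0); exact: cvgD.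
rewrite -[l]add0r (_ : (fun n => _) = (fun n => (D (x' n) (y' n) - D (x n) (y n)) + D (x n) (y n))).
  exact: cvgD.
by apply/funext => n; rewrite subrK.
Qed.

Lemma completion_distE (x y : nat -> E) (l : R) :
  cauchy_seq_in M dist x -> cauchy_seq_in M dist y ->
  D (x n) (y n) @[n --> \oo] --> l ->
  completion_dist dist (cauchy_class M dist x) (cauchy_class M dist y) = l%:E.
Proof.
move=> cx cy hl; rewrite /completion_dist.
(* A class contains the sequence that defines it, so [get] does return one of its members. *)
have /(cauchy_classP _ cx)[cx' hx'] := getPex (ex_intro _ x (cauchy_class_refl cx)).
have /(cauchy_classP _ cy)[cy' hy'] := getPex (ex_intro _ y (cauchy_class_refl cy)).
apply: cvg_lim => //; apply: (cvg_distE _ cx'.1 cy'.1).2.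
exact: (cvg_D_class cx.1 cy.1 cx'.1 cy'.1 hx' hy' hl).
Qed.

Lemma cauchy_class_eq (x y : nat -> E) :
  cauchy_seq_in M dist x -> cauchy_seq_in M dist y ->
  D (x n) (y n) @[n --> \oo] --> (0 : R) ->
  cauchy_class M dist x = cauchy_class M dist y.
Proof.
move=> cx cy hxy; apply/seteqP; split=> z.
  move=> /(cauchy_classP _ cx)[cz hz]; apply/(cauchy_classP _ cy); split=> //.
  apply: (cvg_D_class cx.1 cx.1 cy.1 cz.1) => //.
  exact: D_refl_cvg cx.1.
move=> /(cauchy_classP _ cy)[cz hz]; apply/(cauchy_classP _ cx); split=> //.
apply: (cvg_D_class cy.1 cy.1 cx.1 cz.1) => //.
  rewrite (_ : (fun n => D (y n) (x n)) = (fun n => D (x n) (y n)))//.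
  by apply/funext => n; rewrite D_sym//; [exact: cy.1|exact: cx.1].
exact: D_refl_cvg cy.1.
Qed.

Lemma cauchy_seq_in_cst p : M p -> cauchy_seq_in M dist (fun=> p).
Proof.
move=> Mp; split=> // e e0; exists 0%N => m n _ _.
by rewrite distE// D_refl.
Qed.

(** The distance to p is 1-Lipschitz, so it maps Cauchy sequences to real Cauchy sequences. *)
Lemma cauchy_D_cvg p (z : nat -> E) : M p -> cauchy_seq_in M dist z ->
  cvgn (fun n => D p (z n)).
Proof.
move=> Mp [Mz cz]; apply: cauchy_cvg; apply: cauchy_exP => e e0.
have [N hN] := cz _ e0; exists (D p (z N)); exists N => // n /= Nn.
have := hN N n (leqnn N) Nn; rewrite distE// lte_fin; apply: le_lt_trans.
have := D_quadrangle Mp (Mz n) Mp (Mz N).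
by rewrite D_refl// add0r (D_sym (Mz n)).
Qed.

End CompletionTheory.

(** * Length and Riemannian distance *)

Section PiecewiseC1.
Context {R : realType} {E : normedModType R}.
Implicit Types (c : R -> E) (x y a b t : R).

Lemma derive1_affine c a b t : derivable c (a * t + b) 1 ->
  derivable (fun s => c (a * s + b)) t 1 /\
  derive1 (fun s => c (a * s + b)) t = a *: derive1 c (a * t + b).
Proof.
pose phi s : R := a * s + b.
have dphi : is_derive t 1 phi a.
  by rewrite /phi; apply: is_derive_eq; rewrite addr0 scaler1.
have dp : differentiable phi t by apply/derivable1_diffP; exact: ex_derive.
move=> /derivable1_diffP dc.
have dcp : differentiable (c \o phi) t by exact: differentiable_comp.
split; first exact/derivable1_diffP.
rewrite -[LHS]/(derive1 (c \o phi) t) derive1E'// diff_comp//=.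
have -> : 'd phi t 1 = a *: 1 :> R.
  by rewrite -derive1E'// derive1E (@derive_val _ _ _ _ _ _ _ dphi) scaler1.
by rewrite linearZ /= -derive1E'.
Qed.

Lemma C1_affine c a b : C1_curve c -> C1_curve (fun t => c (a * t + b)).
Proof.
move=> [dc cc]; split=> [t|]; first by have [] := derive1_affine (dc (a * t + b)).
rewrite (_ : derive1 _ = fun t => a *: derive1 c (a * t + b)); last first.
  by apply/funext => t; have [] := derive1_affine (dc (a * t + b)).
move=> t; apply: cvgZr; apply: (@continuous_comp _ _ _ (fun t => a * t + b) (derive1 c)).
  by apply: cvgD; [exact: mulrl_continuous|exact: cvg_cst].
exact: cc.
Qed.

(** An inductive form of [piecewise_C1] on an arbitrary interval: reversal, rescaling, concatenation
    and the splitting of integrals become inductions instead of index computations on lists of break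
    points. *)
Inductive piecewise c : R -> R -> Prop :=
| piecewise_piece x y c' of x < y & C1_curve c' &
    (forall t, x <= t <= y -> c t = c' t) : piecewise c x y
| piecewise_cat x y z of piecewise c x y & piecewise c y z : piecewise c x z.

Lemma piecewise_lt c x y : piecewise c x y -> x < y.
Proof. by elim=> // {}x {}y z _ xy _ yz; exact: lt_trans yz. Qed.

Let pieces c x (s : seq R) := forall i, (i < size s)%N ->
  exists2 c', C1_curve c' &
    forall t, nth 0 (x :: s) i <= t <= nth 0 s i -> c t = c' t.

Let piecewise_of_seq c x (s : seq R) : path <%R x s -> pieces c x s ->
  s != [::] -> piecewise c x (last x s).
Proof.
elim: s x => // y s IH x /= /andP[xy ps] H _.
have xyc : piecewise c x y.
  by have [c' cc' hc'] := H 0%N isT; exact: piecewise_piece hc'.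
case: s => // z s in IH ps H *.
apply: piecewise_cat xyc _; apply: IH => // i si; exact: (H i.+1).
Qed.

Let seq_of_piecewise c x y : piecewise c x y ->
  exists s, [/\ path <%R x s, last x s = y & pieces c x s].
Proof.
elim=> [{}x {}y c' xy cc' hc'|{}x {}y z _ [s [ps <- hs]] _ [s' [ps' <- hs']]].
  by exists [:: y]; split=> //=; [rewrite xy|case=> // _; exists c'].
exists (s ++ s'); split; [by rewrite cat_path ps|by rewrite last_cat|].
move=> i; rewrite size_cat => si.
have [lti|lei] := ltnP i (size s).
  rewrite -cat_cons !nth_cat lti /= ltnS (ltnW lti); exact: hs.
have si' : (i - size s < size s')%N by rewrite ltn_subLR.
have [c' cc' hc'] := hs' _ si'; exists c' => // t.
rewrite -cat_cons !nth_cat (ltnNge i (size s)) lei /= ltnS.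
case: leqP => [le|lt].
  (* The first piece of [s'] starts at the last point of [s], which is the entry of index [size s]
     in [x :: s]. *)
  have iE : i = size s by apply/eqP; rewrite eqn_leq le.
  rewrite iE subnn in hc' *; rewrite -[(size s)]/((size (x :: s)).-1) nth_last /=.
  exact: hc'.
move: hc'; rewrite -(subnSK lt) /= => hc'; rewrite -subSS; exact: hc'.
Qed.

Lemma piecewise_C1P c : piecewise_C1 c <-> piecewise c 0 1.
Proof.
split=> [[s [ps ls hs]]|/seq_of_piecewise[s [ps ls hs]]]; last by exists s.
rewrite -ls; apply: piecewise_of_seq => //.
by apply/eqP => s0; move: ls; rewrite s0 /= => /esym/eqP; rewrite oner_eq0.
Qed.

Lemma piecewise_ext c c2 x y : piecewise c x y ->
  (forall t, x <= t <= y -> c2 t = c t) -> piecewise c2 x y.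
Proof.
elim=> [{}x {}y c' xy cc' hc' h|{}x {}y z cxy IH1 cyz IH2 h].
  by apply: piecewise_piece cc' _ => // t ht; rewrite h// hc'.
have xy := piecewise_lt cxy; have yz := piecewise_lt cyz.
apply: (@piecewise_cat _ _ y).
  by apply: IH1 => t /andP[xt ty]; apply: h; rewrite xt (le_trans ty)// ltW.
by apply: IH2 => t /andP[yt tz]; apply: h; rewrite tz andbT (le_trans _ yt)// ltW.
Qed.

Lemma piecewise_affine c x y a b : 0 < a -> piecewise c x y ->
  piecewise (fun t => c (a * t + b)) ((x - b) / a) ((y - b) / a).
Proof.
move=> a0; elim=> [{}x {}y c' xy cc' hc'|{}x {}y z _ h1 _ h2]; last exact: piecewise_cat h2.
apply: piecewise_piece (C1_affine a b cc') _.
  by rewrite ltr_pM2r ?invr_gt0// ltrD2r.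
move=> t; rewrite ler_pdivrMr// ler_pdivlMr// => /andP[? ?].
by apply: hc'; apply/andP; split; lra.
Qed.

Lemma piecewise_rev c x y b : piecewise c x y ->
  piecewise (fun t => c (-1 * t + b)) (b - y) (b - x).
Proof.
elim=> [{}x {}y c' xy cc' hc'|{}x {}y z _ h1 _ h2]; last exact: piecewise_cat h1.
apply: piecewise_piece (C1_affine (-1) b cc') _; first lra.
by move=> t /andP[? ?]; apply: hc'; apply/andP; split; lra.
Qed.

(** A C^1 piece controls [c] only on a closed interval, so [derive1 c] is under control only in its
    interior. Discarding the end points of all pieces leaves times near which [c] is a C^1 curve. *)
Lemma piecewise_regular c x y : piecewise c x y ->
  exists2 N : set R, finite_set N & forall t, x <= t <= y -> ~ N t ->
    x < t < y /\ exists2 c', C1_curve c' & {near t, c =1 c'}.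
Proof.
elim=> [{}x {}y c' xy cc' hc'|{}x {}y z cxy [N cN hN] cyz [N' cN' hN']].
  exists [set x; y]; first exact: finite_set2.
  move=> t /andP[xt ty] /= /not_orP[/eqP tx /eqP ty'].
  have xty : x < t < y by rewrite !lt_neqAle xt ty ty' eq_sym tx.
  split=> //; exists c' => //; near=> u; apply: hc'.
  have : u \in `]x, y[ by near: u; exact: near_in_itvoo.
  by rewrite in_itv/= => /andP[/ltW -> /ltW ->].
have xy := piecewise_lt cxy; have yz := piecewise_lt cyz.
exists (N `|` N'); first by rewrite finite_setU.
move=> t /andP[xt tz] /not_orP[Nt N't].
have [ty|yt] := leP t y.
  have [|/andP[xt' ty'] H] := hN t _ Nt; first by rewrite xt.
  by rewrite xt' (lt_trans ty').
have [|/andP[yt' tz'] H] := hN' t _ N't; first by rewrite (ltW yt).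
by rewrite tz' andbT (lt_trans xy).
Unshelve. all: by end_near. Qed.

End PiecewiseC1.

(** * Reparametrization, symmetry and the triangle inequality *)

Section Length.
Context {R : realType} {E : normedModType R}.
Variable X : riem_space E.
Hypothesis metricZ : forall x v (k : R), k != 0 ->
  metric X x (k *: v) = k ^+ 2 * metric X x v.
Implicit Types (c : R -> E) (a b t : R) (x y z : E).
Notation mu := (@lebesgue_measure R).

Let speed c t : \bar R := (Num.sqrt (metric X (c t) (derive1 c t)))%:E.

Let speed_ge0 c t : (0 <= speed c t)%E.
Proof. by rewrite lee_fin sqrtr_ge0. Qed.

(** By the chain rule and homogeneity of the metric, the speed is multiplied by |a|, off the
    finitely many irregular times; the change of variables absorbs this factor. *)
Lemma speed_affine_le c c2 (x y x2 y2 a b : R) : a != 0 -> piecewise c x y ->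
  (forall t, (x2 <= t <= y2) = (x <= a * t + b <= y)) ->
  (forall t, x2 <= t <= y2 -> c2 t = c (a * t + b)) ->
  (\int[mu]_(t in `[x2, y2]) speed c2 t <= \int[mu]_(t in `[x, y]) speed c t)%E.
Proof.
move=> a0 pc E2 H; have [N cN hN] := piecewise_regular pc.
rewrite (_ : `[x2, y2]%classic = [set t | `[x, y]%classic (a * t + b)]); last first.
  by apply/seteqP; split => t /=; rewrite !in_itv/= E2.
(* The end points are added because [c2] is given by [c] on the closed interval only, which says
   nothing about its derivative there. *)
have cN' : finite_set [set t | N (a * t + b) \/ t = x2 \/ t = y2].
  rewrite (_ : mkset _ = ((fun s => (s - b) / a) @` N) `|` [set x2; y2]).
    rewrite finite_setU; split; first exact: finite_image.
    exact: finite_set2.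
  apply/seteqP; split=> t /=.
    by move=> [Nt|h]; [left; exists (a * t + b) => //; field|right].
  by move=> [[s Ns <-]|h]; [left; rewrite (_ : _ + b = s)//; field|right].
apply: (ge0_le_integral_affine a0 _ (finite_set_countable cN')) => //.
move=> t; rewrite /= in_itv/= -E2 => ht /not_orP[Nt /not_orP[/eqP tx /eqP ty]].
have t2 : t \in `]x2, y2[.
  by move: ht => /andP[xt yt]; rewrite in_itv/= !lt_neqAle xt yt ty eq_sym tx.
have [|_ [c' [dc' _] hc']] := hN (a * t + b) _ Nt; first by rewrite -E2.
have dc : derivable c (a * t + b) 1.
  by apply: near_eq_derivable (dc' _); near=> u; apply/esym; near: u.
have [_ dE] := derive1_affine dc.
have near2 : {near t, c2 =1 fun s => c (a * s + b)}.
  near=> u; apply: H; have : u \in `]x2, y2[ by near: u; exact: near_in_itvoo.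
  by rewrite in_itv/= => /andP[/ltW -> /ltW ->].
have d2E : derive1 c2 t = a *: derive1 c (a * t + b).
  by rewrite -dE !derive1E; exact: near_eq_derive.
rewrite /speed d2E H// metricZ// -EFinM lee_fin sqrtrM ?sqr_ge0//.
by rewrite sqrtr_sqr.
Unshelve. all: by end_near. Qed.

Lemma curve_length_ge0 c : (0 <= curve_length X c)%E.
Proof. by apply: integral_ge0 => t _; rewrite lee_fin sqrtr_ge0. Qed.

Lemma riem_dist_ge0 x y : (0 <= riem_dist X x y)%E.
Proof.
by apply: le_ereal_inf_tmp => _ [c _ <-]; exact: curve_length_ge0.
Qed.

Lemma riem_dist_le x y c : admissible X c -> c 0 = x -> c 1 = y ->
  (riem_dist X x y <= curve_length X c)%E.
Proof. by move=> ac c0 c1; apply: ereal_inf_lbound; exists c. Qed.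

Let riem_dist_sym_le x y : (riem_dist X y x <= riem_dist X x y)%E.
Proof.
apply: le_ereal_inf_tmp => _ [c [[Xc /piecewise_C1P pc] c0 c1] <-].
pose c2 t := c (-1 * t + 1).
have ac2 : admissible X c2.
  split=> [t /andP[t0 t1]|]; first by apply: Xc; apply/andP; split; lra.
  by apply/piecewise_C1P; have := piecewise_rev 1 pc; rewrite subrr subr0.
apply: le_trans (riem_dist_le ac2 _ _) _.
- by rewrite /c2 mulr0 add0r.
- by rewrite /c2 mulN1r addNr.
apply: (@speed_affine_le c c2 0 1 0 1 (-1) 1) => //.
by move=> t; apply/andP/andP => -[? ?]; split; lra.
Qed.

Lemma riem_dist_sym x y : riem_dist X x y = riem_dist X y x.
Proof. by apply/eqP; rewrite eq_le !riem_dist_sym_le. Qed.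

Definition curve_concat c1 c2 t := if t <= 2^-1 then c1 (2 * t) else c2 (2 * t - 1).

Lemma curve_concat_admissible c1 c2 : admissible X c1 -> admissible X c2 ->
  c1 1 = c2 0 -> admissible X (curve_concat c1 c2).
Proof.
move=> [Xc1 /piecewise_C1P p1] [Xc2 /piecewise_C1P p2] c12; split.
  move=> t /andP[t0 t1]; rewrite /curve_concat; case: leP => ht.
    by apply: Xc1; apply/andP; split; lra.
  by apply: Xc2; apply/andP; split; lra.
apply/piecewise_C1P; apply: (@piecewise_cat _ _ _ _ 2^-1).
  have := piecewise_affine 0 (ltr0Sn R 1) p1.
  rewrite !subr0 mul0r div1r => /piecewise_ext; apply => t /andP[_ ht].
  by rewrite /curve_concat ht addr0.
have := piecewise_affine (-1) (ltr0Sn R 1) p2.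
rewrite !opprK add0r div1r mulfV ?pnatr_eq0// => /piecewise_ext; apply => t /andP[ht _].
rewrite /curve_concat; case: leP => // h.
have -> : t = 2^-1 by apply/eqP; rewrite eq_le h.
by rewrite mulfV ?pnatr_eq0// c12 subrr.
Qed.

Lemma curve_concat_length c1 c2 : admissible X c1 -> admissible X c2 ->
  c1 1 = c2 0 ->
  (curve_length X (curve_concat c1 c2) <= curve_length X c1 + curve_length X c2)%E.
Proof.
move=> [Xc1 /piecewise_C1P p1] [Xc2 /piecewise_C1P p2] c12.
rewrite {1}/curve_length.
rewrite (_ : `[0%R, 1%R]%classic = `[0%R, 2^-1]%classic `|` `]2^-1, 1%R]%classic); last first.
  by rewrite -itv_bndbnd_setU// !bnd_simp; lra.
apply: le_trans (ge0_integral_setU_le _ _ _ _) _ => //.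
- apply/disj_setPS => t [] /=; rewrite !in_itv/= => /andP[_ h1] /andP[h2 _].
  by have := lt_le_trans h2 h1; rewrite ltxx.
apply: leeD.
  apply: (@speed_affine_le c1 _ 0 1 0 2^-1 2 0); rewrite ?pnatr_eq0//.
    by move=> t; apply/andP/andP => -[? ?]; split; lra.
  by move=> t /andP[_ ht]; rewrite /curve_concat ht addr0.
(* The midpoint is put back to obtain a closed interval; both branches agree there since
   [c1 1 = c2 0]. *)
apply: (@le_trans _ _ (\int[mu]_(t in `[(2^-1)%R, 1%R]) speed (curve_concat c1 c2) t)%E).
  by apply: ge0_integral_subset_le => // t /=; rewrite !in_itv/= => /andP[/ltW -> ->].
apply: (@speed_affine_le c2 _ 0 1 2^-1 1 2 (-1)); rewrite ?pnatr_eq0//.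
  by move=> t; apply/andP/andP => -[? ?]; split; lra.
move=> t /andP[ht _]; rewrite /curve_concat; case: leP => // h.
have -> : t = 2^-1 by apply/eqP; rewrite eq_le h.
by rewrite mulfV ?pnatr_eq0// c12 subrr.
Qed.

Lemma riem_dist_triangle x y z :
  (riem_dist X x z <= riem_dist X x y + riem_dist X y z)%E.
Proof.
have [fxy|] := boolP (riem_dist X x y \is a fin_num); last first.
  rewrite ge0_fin_numE ?riem_dist_ge0// -leNgt leye_eq => /eqP ->.
  by rewrite addye ?leey// gt_eqF// (lt_le_trans _ (riem_dist_ge0 _ _)).
have [fyz|] := boolP (riem_dist X y z \is a fin_num); last first.
  rewrite ge0_fin_numE ?riem_dist_ge0// -leNgt leye_eq => /eqP ->.
  by rewrite addey ?leey// gt_eqF// (lt_le_trans _ (riem_dist_ge0 _ _)).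
apply/lee_addgt0Pr => e e0; have e2 : 0 < e / 2 by lra.
have [_ [c1 [a1 c10 c11] <-] l1] := lb_ereal_inf_adherent e2 fxy.
have [_ [c2 [a2 c20 c21] <-] l2] := lb_ereal_inf_adherent e2 fyz.
have c12 : c1 1 = c2 0 by rewrite c11 c20.
apply: (@le_trans _ _ (curve_length X (curve_concat c1 c2))).
  apply: riem_dist_le (curve_concat_admissible a1 a2 c12) _ _.
    by rewrite /curve_concat invr_ge0 ler0n mulr0.
  rewrite /curve_concat; case: leP => h; first by exfalso; lra.
  by rewrite -c21; congr c2; lra.
apply: (le_trans (curve_concat_length a1 a2 c12)).
rewrite (splitr e) EFinD [leRHS]addeACA. apply: leeD; [exact: (ltW l1)|exact: (ltW l2)].
Qed.

End Length.

(** * Lower bound of lengths by the variation of a function *)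

Section LengthLowerBound.
Context {R : realType} {E : normedModType R}.
Variables (X : riem_space E) (F : E -> R).
Notation mu := (@lebesgue_measure R).
Implicit Types (c : R -> E) (x y t : R).
Hypothesis F_C1 : forall c t, C1_curve c -> carrier X (c t) ->
  derivable (F \o c) t 1 /\ {for t, continuous (derive1 (F \o c))}.
(** The curve stays in the carrier near t, and not only at t, so that its velocity is tangent. *)
Hypothesis F_le : forall c t, C1_curve c -> (\forall u \near t, carrier X (c u)) ->
  `|derive1 (F \o c) t| <= Num.sqrt (metric X (c t) (derive1 c t)).

Let G c t := derive1 (F \o c) t.

(** On one piece this is the fundamental theorem of calculus for the C^1 extension; pieces are
    joined by the triangle inequality. Measurability is carried through the induction because the
    integral of |G| has to split exactly. *)
Lemma piecewise_variation c x y : piecewise c x y ->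
  (forall t, x <= t <= y -> carrier X (c t)) ->
  measurable_fun (`[x, y] : set (measurableTypeR R)) (G c) /\
  (`|F (c y) - F (c x)|%:E <= \int[mu]_(t in `[x, y]) `|G c t|%:E)%E.
Proof.
elim=> [{}x {}y c' xy cc' hc' Xc|{}x {}y z cxy IH1 cyz IH2 Xc].
  pose f := derive1 (F \o c').
  have Xc' t : x <= t <= y -> carrier X (c' t) by move=> ht; rewrite -hc'//; exact: Xc.
  have cf : {within `[x, y], continuous f}.
    apply: continuous_in_subspaceT => t; rewrite inE/= in_itv/= => /Xc' /(F_C1 cc')[_].
    exact.
  have cont t : x <= t <= y -> {for t, continuous (F \o c')}.
    move=> /Xc' /(F_C1 cc')[/derivable1_diffP/differentiable_continuous h _].
    exact: h.
  have dF : derivable_oo_LRcontinuous (F \o c') x y.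
    split.
    - move=> t; rewrite in_itv/= => /andP[/ltW h1 /ltW h2].
      by apply: (F_C1 cc' _).1; apply: Xc'; rewrite h1.
    - by apply: cvg_at_right_filter; apply: cont; rewrite lexx ltW.
    - by apply: cvg_at_left_filter; apply: cont; rewrite lexx ltW.
  have FTC := continuous_FTC2 xy cf dF (fun _ _ => erefl).
  have mf : measurable_fun (`[x, y] : set (measurableTypeR R)) f.
    exact: subspace_continuous_measurable_fun.
  (* On the open interval [c] and its extension agree near each point, hence so do the
     derivatives. *)
  have fG : {in `]x, y[, f =1 G c}.
    move=> t txy; rewrite /f /G !derive1E; apply: near_eq_derive.
    near=> u; rewrite /= hc'//.
    have : u \in `]x, y[ by near: u; exact: near_in_itvoo.
    by rewrite in_itv/= => /andP[/ltW -> /ltW ->].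
  split.
    apply: (@measurable_fun_itv_cc _ _ _ false true); apply: (eq_measurable_fun f).
      by move=> t; rewrite inE/= => /fG.
    by apply: measurable_funS mf => // t /=; rewrite !in_itv/= => /andP[/ltW -> /ltW ->].
  rewrite !hc'; [|by rewrite lexx ltW|by rewrite lexx ltW].
  have := le_abse_integral mu (measurable_itv `[x, y]) ((measurable_EFinP _ _).2 mf).
  rewrite FTC -EFinB /= => h; apply: (le_trans h).
  apply: (@ge0_le_integral_countable _ _ [set x; y]) => //.
  - exact/finite_set_countable/finite_set2.
  - by move=> t; rewrite /= in_itv/= => /andP[h1 h2] /not_orP[/eqP h3 /eqP h4];
      rewrite fG// in_itv/= !lt_neqAle h1 h2 h4 eq_sym h3.
have xy := piecewise_lt cxy; have yz := piecewise_lt cyz.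
have [|m1 l1] := IH1 _.
  by move=> t /andP[h1 h2]; apply: Xc; rewrite h1 (le_trans h2)// ltW.
have [|m2 l2] := IH2 _.
  by move=> t /andP[h1 h2]; apply: Xc; rewrite h2 andbT (le_trans _ h1)// ltW.
have E2 : `[x, z]%classic = `[x, y]%classic `|` `]y, z]%classic :> set (measurableTypeR R).
  by rewrite -itv_bndbnd_setU// !bnd_simp ltW.
have m2' : measurable_fun (`]y, z] : set (measurableTypeR R)) (G c).
  by apply: measurable_funS m2 => // t /=; rewrite !in_itv/= => /andP[/ltW -> ->].
have m12 : measurable_fun (`[x, z] : set (measurableTypeR R)) (G c).
  by rewrite E2; apply/measurable_funU.
split=> //; rewrite E2 ge0_integral_setU//=; last first.
- apply/disj_setPS => t [] /=; rewrite !in_itv/= => /andP[_ h1] /andP[h2 _].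
  by have := lt_le_trans h2 h1; rewrite ltxx.
- by rewrite -E2; apply/measurable_EFinP; apply: measurableT_comp => //.
rewrite [X in (_ <= _ + X)%E]integral_itv_obnd_cbnd; last first.
  by apply/measurable_EFinP; apply: measurableT_comp.
apply: le_trans (leeD l1 l2); rewrite -EFinD lee_fin.
rewrite (_ : F (c z) - _ = (F (c y) - F (c x)) + (F (c z) - F (c y))).
  exact: ler_normD.
by ring.
Unshelve. all: by end_near. Qed.

Lemma riem_dist_ge (p q : E) : (`|F q - F p|%:E <= riem_dist X p q)%E.
Proof.
apply: le_ereal_inf_tmp => _ [c [[Xc /piecewise_C1P pc] <- <-] <-].
have [_ /le_trans] := piecewise_variation pc Xc; apply.
have [N fN hN] := piecewise_regular pc.
apply: (@ge0_le_integral_countable _ _ N) => //.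
- exact: finite_set_countable.
- move=> t; rewrite /= in_itv/= => ht Nt; have [t01 [c' cc' nc]] := hN t ht Nt.
  rewrite lee_fin.
  have nc' : {near t, c' =1 c} by near=> u; apply/esym; near: u.
  have ct : c t = c' t by exact: (nbhs_singleton nc).
  have -> : G c t = derive1 (F \o c') t.
    rewrite /G !derive1E; apply: near_eq_derive; near=> u => /=.
    by rewrite (near nc u).
  have -> : derive1 c t = derive1 c' t by rewrite !derive1E; exact: near_eq_derive.
  rewrite ct; apply: F_le => //; near=> u.
  have -> : c' u = c u by near: u.
  apply: Xc; have : u \in `]0, 1[ by near: u; apply: near_in_itvoo; rewrite in_itv.
  by rewrite in_itv/= => /andP[/ltW -> /ltW ->].
Unshelve. all: by end_near. Qed.

End LengthLowerBound.

(** * The distance on scaled Gaussians *)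

Section DeriveAux.
Context {R : realType} {E W : normedModType R}.

Lemma derive1_lin (L : {linear E -> W}) (c : R -> E) (t : R) : continuous L ->
  derivable c t 1 ->
  derivable (L \o c) t 1 /\ derive1 (L \o c) t = L (derive1 c t).
Proof.
move=> cL /derivable1_diffP dc.
have dL x : differentiable L x by exact: linear_differentiable.
have dLc : differentiable (L \o c) t by exact: differentiable_comp.
split; first exact/derivable1_diffP.
by rewrite !derive1E'// diff_comp// diff_lin.
Qed.

Lemma derive1_pair (f : R -> E) (g : R -> W) (t : R) :
  derivable f t 1 -> derivable g t 1 ->
  derivable (fun s => (f s, g s)) t 1 /\
  derive1 (fun s => (f s, g s)) t = (derive1 f t, derive1 g t).
Proof.
move=> /derivable1_diffP df /derivable1_diffP dg.
have dfg : differentiable (fun s => (f s, g s)) t by exact: differentiable_pair.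
split; first exact/derivable1_diffP.
by rewrite !derive1E'// diff_pair.
Qed.

Lemma fst_continuous : continuous (@fst E W).
Proof. by move=> [x y]; exact: cvg_fst. Qed.

Lemma snd_continuous : continuous (@snd E W).
Proof. by move=> [x y]; exact: cvg_snd. Qed.

End DeriveAux.

Lemma near_eq_continuous_at (T U : topologicalType) (f g : T -> U) (x : T) :
  {near x, f =1 g} -> {for x, continuous g} -> {for x, continuous f}.
Proof.
move=> fg cg; rewrite /prop_for /continuous_at (nbhs_singleton fg).
apply: cvg_trans cg; apply: near_eq_cvg.
by apply: filterS fg => y /esym.
Qed.

Section GaussPlus.
Context {R : realType} {d : nat}.
Local Notation mean_cov := ('cV[R]_d * 'M[R]_d)%type.
Variable r : R.
Hypothesis r0 : 0 < r.
Local Notation gU := (@gauss_plus R d r).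
Local Notation radius := (@cone_radius R d r).
Implicit Types (c : R -> R * mean_cov) (mu nu : mean_cov) (al : R * mean_cov).

Lemma radius_gt0 al : 0 < al.1 -> 0 < radius al.
Proof. by move=> a0; rewrite mulr_gt0// sqrtr_gt0 mulr_gt0. Qed.

Lemma gauss_plus_metricZ al v (k : R) : k != 0 ->
  metric gU al (k *: v) = k ^+ 2 * metric gU al v.
Proof. by move=> k0 /=; rewrite g_parZ// -[k *: v.1]/(k * v.1); ring. Qed.

Lemma derive1_radius c t : derivable c t 1 -> 0 < (c t).1 ->
  derivable (radius \o c) t 1 /\
  derive1 (radius \o c) t = r / Num.sqrt (r * (c t).1) * (derive1 c t).1.
Proof.
move=> dc a0.
have [d1 e1] := derive1_lin (L := [the {linear _ -> _} of fst]) (@fst_continuous _ _ _) dc.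
have i1 : is_derive t 1 (fun s => (c s).1) (derive1 c t).1.
  by split=> //; rewrite -derive1E e1.
have i2 : is_derive t 1 (fun s => r * (c s).1) (r * (derive1 c t).1).
  exact: is_deriveZ.
have ra0 : 0 < r * (c t).1 by rewrite mulr_gt0.
have i3 := @is_derive1_comp _ Num.sqrt (fun s => r * (c s).1) t _ _ (is_derive1_sqrt ra0) i2.
have i4 : is_derive t 1 (radius \o c)
    (2 * ((2 * Num.sqrt (r * (c t).1))^-1 * (r * (derive1 c t).1))).
  exact: (is_deriveZ 2 i3).
split; first exact: ex_derive.
rewrite derive1E (@derive_val _ _ _ _ _ _ _ i4); field.
by rewrite gt_eqF// sqrtr_gt0.
Qed.

Lemma radius_C1 c t : C1_curve c -> carrier gU (c t) ->
  derivable (radius \o c) t 1 /\ {for t, continuous (derive1 (radius \o c))}.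
Proof.
move=> [dc cc] [a0 _]; split; first exact: (derive1_radius (dc t) a0).1.
have ca s : {for s, continuous (fun u => (c u).1)}.
  apply: (@continuous_comp _ _ _ c fst); last exact: fst_continuous.
  by apply: differentiable_continuous; exact/derivable1_diffP.
apply: (@near_eq_continuous_at _ _ _ (fun s => r / Num.sqrt (r * (c s).1) * (derive1 c s).1)).
  have : \forall s \near t, 0 < (c s).1 by exact: (cvgr_gt (c t).1 (ca t)).
  by apply: filterS => s as0; rewrite (derive1_radius (dc s) as0).2.
have ra0 : 0 < r * (c t).1 by rewrite mulr_gt0.
apply: cvgM; last first.
  by apply: (@continuous_comp _ _ _ (derive1 c) fst); [exact: cc|exact: fst_continuous].
apply: cvgM; first exact: cvg_cst.
apply: cvgV; first by rewrite gt_eqF// sqrtr_gt0.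
apply: (@continuous_comp _ _ _ (fun s => r * (c s).1) Num.sqrt); last exact: sqrt_continuous.
by apply: cvgM; [exact: cvg_cst|exact: ca].
Qed.

(** Symmetry of the covariance at all nearby times passes to the derivative entry by entry. *)
Lemma derive1_tangent c t : C1_curve c -> (\forall u \near t, carrier gU (c u)) ->
  gauss_tangent (derive1 c t).2.
Proof.
move=> [dc _] Xc.
have [d2 e2] := derive1_lin (L := [the {linear _ -> _} of snd]) (@snd_continuous _ _ _) (dc t).
have [d3 e3] := derive1_lin (L := [the {linear _ -> _} of snd]) (@snd_continuous _ _ _) d2.
rewrite /gauss_tangent /=.
have -> : (derive1 c t).2.2 = derive1 (fun s => (c s).2.2) t.
  by rewrite -[RHS]/(derive1 (snd \o (snd \o c)) t) e3 e2.
rewrite derive1E derive_mx//; apply/matrixP => i j; rewrite !mxE.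
apply: near_eq_derive; apply: filterS Xc => s [_ [Ss _]].
by rewrite -[in LHS]Ss mxE.
Qed.

Lemma radius_le c t : C1_curve c -> (\forall u \near t, carrier gU (c u)) ->
  `|derive1 (radius \o c) t| <= Num.sqrt (metric gU (c t) (derive1 c t)).
Proof.
move=> cc Xc; have ts := derive1_tangent cc Xc.
have [a0 Sp] := nbhs_singleton Xc.
rewrite (derive1_radius (cc.1 t) a0).2 -sqrtr_sqr ler_wsqrtr//=.
rewrite exprMn exprMn exprVn sqr_sqrtr; last by rewrite ltW// mulr_gt0.
have -> : r ^+ 2 / (r * (c t).1) = r / (c t).1 by field; rewrite !gt_eqF.
by rewrite lerDl mulr_ge0// ?(ltW a0)// g_par_ge0.
Qed.

Lemma gauss_plus_dist_ge al be :
  (`|radius be - radius al|%:E <= riem_dist gU al be)%E.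
Proof. exact: (riem_dist_ge radius_C1 radius_le). Qed.

Lemma radius_radial (rho : R) mu : 0 <= rho -> radius (of_cone r (rho, mu)) = rho.
Proof.
move=> rho0; rewrite /cone_radius /of_cone /=.
have -> : r * (rho ^+ 2 / (4 * r)) = (rho / 2) ^+ 2 by field; rewrite gt_eqF.
by rewrite sqrtr_sqr ger0_norm ?divr_ge0//; field.
Qed.

Lemma of_coneK mu (a : R) : 0 < a -> of_cone r (radius (a, mu), mu) = (a, mu).
Proof.
move=> a0; rewrite /of_cone /cone_radius /= exprMn sqr_sqrtr; last by rewrite ltW// mulr_gt0.
by congr pair; field; rewrite gt_eqF.
Qed.

Lemma derive1_radial (rho k t : R) mu :
  derivable (fun s => of_cone r (rho + k * s, mu)) t 1 /\
  derive1 (fun s => of_cone r (rho + k * s, mu)) t = (k * (rho + k * t) / (2 * r), 0).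
Proof.
have i1 : is_derive t 1 (fun s : R => (rho + k * s) ^+ 2 / (4 * r)) (k * (rho + k * t) / (2 * r)).
  apply: is_derive_eq; rewrite ?scaler0 ?add0r ?addr0 -?[_ *: _]/(_ * _).
  by field; rewrite gt_eqF.
have [d1 e1] := derive1_pair (@ex_derive _ _ _ _ _ _ _ i1) (derivable_cst mu t 1).
split=> //; rewrite -[LHS]/(derive1 (fun s => ((rho + k * s) ^+ 2 / (4 * r), cst mu s)) t) e1.
by rewrite derive1_cst derive1E (@derive_val _ _ _ _ _ _ _ i1).
Qed.

Lemma radial_C1 (rho k : R) mu : C1_curve (fun s => of_cone r (rho + k * s, mu)).
Proof.
split=> [t|t]; first exact: (derive1_radial rho k t mu).1.
rewrite (_ : derive1 _ = fun t => (k * (rho + k * t) / (2 * r), 0)); last first.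
  by apply/funext => s; exact: (derive1_radial rho k s mu).2.
apply: differentiable_continuous.
apply: (differentiable_pair (f := fun s => k * (rho + k * s) / (2 * r))) => //.
Qed.

(** Since a = rho^2 / (4 r), the vector [(k * rho / (2 * r), 0)] is the velocity of a radial curve
    with rho' = k. *)
Lemma metric_radial (rho k : R) mu : 0 < rho -> gauss1 mu ->
  metric gU (of_cone r (rho, mu)) (k * rho / (2 * r), 0) = k ^+ 2.
Proof.
move=> rho0 Sp /=; rewrite g_par0// mulr0 addr0; field.
by rewrite !gt_eqF.
Qed.

Lemma C1_admissible c : C1_curve c -> (forall t, 0 <= t <= 1 -> carrier gU (c t)) ->
  admissible gU c.
Proof.
by move=> cc Xc; split=> //; apply/piecewise_C1P; apply: (piecewise_piece ltr01 cc).
Qed.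

Lemma curve_length_le c (C : R) : 0 <= C ->
  (forall t, 0 <= t <= 1 -> metric gU (c t) (derive1 c t) <= C ^+ 2) ->
  (curve_length gU c <= C%:E)%E.
Proof.
move=> C0 h; apply: (@le_trans _ _ (\int[@lebesgue_measure R]_(t in `[0%R, 1%R]) C%:E)%E).
  apply: (@ge0_le_integral_countable _ _ set0) => //.
  move=> t; rewrite /= in_itv/= => ht _; rewrite lee_fin.
  by rewrite -[leRHS]ger0_norm// -sqrtr_sqr ler_wsqrtr// h.
rewrite integral_cst//= lebesgue_measure_itv/= lte_fin ltr01.
by rewrite oppr0 adde0 mule1.
Qed.

Lemma gauss_plus_radial_dist mu (a0 a1 : R) : gauss1 mu -> 0 < a0 -> 0 < a1 ->
  riem_dist gU (a0, mu) (a1, mu) = `|radius (a1, mu) - radius (a0, mu)|%:E.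
Proof.
move=> Sp a00 a10; apply/eqP; rewrite eq_le gauss_plus_dist_ge andbT.
set rho0 := radius (a0, mu); set rho1 := radius (a1, mu).
have rho00 : 0 < rho0 by exact: radius_gt0.
have rho10 : 0 < rho1 by exact: radius_gt0.
pose c s := of_cone r (rho0 + (rho1 - rho0) * s, mu).
have pos s : 0 <= s <= 1 -> 0 < rho0 + (rho1 - rho0) * s.
  move=> /andP[s0 s1]; rewrite (_ : _ + _ = (1 - s) * rho0 + s * rho1); last by ring.
  move: s0; rewrite le_eqVlt => /predU1P[<-|s0]; first by rewrite subr0 mul1r mul0r addr0.
  apply: ltr_wpDl; last exact: mulr_gt0.
  by apply: mulr_ge0; [rewrite subr_ge0|exact: ltW].
have ac : admissible gU c.
  apply: C1_admissible; first exact: radial_C1.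
  by move=> s /pos hs; split=> //=; rewrite divr_gt0 ?exprn_gt0// mulr_gt0.
apply: le_trans (riem_dist_le ac _ _) _.
- by rewrite /c mulr0 addr0 of_coneK.
- by rewrite /c mulr1 addrC subrK of_coneK.
apply: curve_length_le => // s hs.
rewrite /c (derive1_radial rho0 (rho1 - rho0) s mu).2 metric_radial//; last exact: pos.
by rewrite real_normK// num_real.
Qed.

Lemma gauss_plus_shape_dist mu nu : gauss1 mu -> gauss1 nu ->
  exists2 C : R, 0 <= C & forall a : R, 0 < a ->
    (riem_dist gU (a, mu) (a, nu) <= (C * Num.sqrt a)%:E)%E.
Proof.
move=> Sm Sn; have [C hC] := gauss_segment r0 Sm Sn.
have ts : gauss_tangent (nu - mu) by apply: gauss_tangentB; exact: spd_sym.
have C0 : 0 <= C.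
  have [|S0 h] := hC 0; first by rewrite lexx ler01.
  by apply: le_trans h; exact: g_par_ge0.
(* Along the segment of shapes at constant mass a, the squared speed is a times the parallel sum,
   hence at most a C. *)
exists (Num.sqrt C); first exact: sqrtr_ge0.
move=> a a0; pose c s : R * mean_cov := (a, mu + s *: (nu - mu)).
have dc s : derivable c s 1 /\ derive1 c s = (0, nu - mu).
  have i2 : is_derive s 1 (fun u : R => mu + u *: (nu - mu)) (nu - mu).
    rewrite -[X in is_derive _ _ _ X]add0r; apply: is_deriveD.
    have dl : differentiable (fun u : R => u *: (nu - mu)) s.
      exact: (@differentiableZl _ _ _ id).
    split; first exact/derivable1_diffP.
    by rewrite -derive1E derive1E'// (@diffZl _ _ _ id)//= -derive1E'// derive1_id scale1r.
  have [d1 e1] := derive1_pair (derivable_cst a s 1) (@ex_derive _ _ _ _ _ _ _ i2).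
  split=> //; rewrite -[LHS]/(derive1 (fun u => (cst a u, mu + u *: (nu - mu))) s) e1.
  by rewrite derive1_cst derive1E (@derive_val _ _ _ _ _ _ _ i2).
have ac : admissible gU c.
  apply: C1_admissible; last by move=> s /hC[].
  split=> [s|s]; first exact: (dc s).1.
  rewrite (_ : derive1 c = cst (0, nu - mu)); first exact: cvg_cst.
  by apply/funext => u; exact: (dc u).2.
apply: le_trans (riem_dist_le ac _ _) _.
- by rewrite /c scale0r addr0.
- by rewrite /c scale1r addrC subrK.
apply: curve_length_le; first by rewrite mulr_ge0// sqrtr_ge0.
move=> s /hC[Ss hs]; rewrite (dc s).2 /= expr0n/= mulr0 add0r exprMn !sqr_sqrtr// ?(ltW a0)//.
by rewrite mulrC ler_wpM2r// ltW.
Qed.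

(** Change the mass at fixed shape, then the shape at fixed mass: both parts have finite length. *)
Lemma gauss_plus_dist_fin al be : carrier gU al -> carrier gU be ->
  riem_dist gU al be \is a fin_num.
Proof.
case: al be => [a mu] [b nu] [/= a0 Sm] [/= b0 Sn].
rewrite ge0_fin_numE ?riem_dist_ge0//.
apply: (le_lt_trans (riem_dist_triangle gauss_plus_metricZ _ (b, mu) _)).
rewrite gauss_plus_radial_dist//.
have [C _ /(_ b b0) h] := gauss_plus_shape_dist Sm Sn.
by rewrite lte_add_pinfty ?ltry// (le_lt_trans h) ?ltry.
Qed.

End GaussPlus.

(** * Smoothness in cone coordinates *)

Section SmoothAux.
Context {R : realType} {V W : normedModType R}.

Lemma near_eq_differentiable (f g : V -> W) (x : V) :
  {near x, f =1 g} -> differentiable g x -> differentiable f x.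
Proof.
move=> fg dg.
have E : f \o shift x = cst (f x) + 'd g x +o_ (0 : V) id.
  apply/eqaddoP => e e0.
  have [_ /eqaddoP/(_ e e0) H] := (diff_locallyP _ _).1 dg.
  move: (fg); rewrite (near_shift 0) subr0 => fg0.
  near=> h.
  have fgh : f (h + x) = g (h + x) by near: h.
  have : `|(g \o shift x - (cst (g x) + 'd g x)) h| <= e * `|id h| by near: h.
  by rewrite !fctE /= fgh (nbhs_singleton fg).
have cg : continuous ('d g x) by exact: diff_continuous.
by apply/diff_locallyP; rewrite (diff_unique cg E).
Unshelve. all: by end_near. Qed.

(** [Ck_on] speaks of functions on the whole space, whereas the formulas for derivatives hold only
    at positive mass. *)
Lemma Ck_on_ext (k : nat) (U : set V) (f g : V -> W) : open U ->
  (forall x, U x -> f x = g x) -> Ck_on k U g -> Ck_on k U f.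
Proof.
move=> oU; elim: k f g => [|k IH] f g fg.
  move=> cg x Ux; apply: near_eq_continuous_at (cg _ Ux).
  by near=> y; apply: fg; near: y; exact: open_nbhs_nbhs.
move=> [dg Dg]; split=> [x Ux|v].
  apply: near_eq_differentiable (dg _ Ux).
  by near=> y; apply: fg; near: y; exact: open_nbhs_nbhs.
apply: IH (Dg v) => x Ux; apply: near_eq_derive.
by near=> y; apply: fg; near: y; exact: open_nbhs_nbhs.
Unshelve. all: by end_near. Qed.

(** Agreement on the line through x suffices. A full neighbourhood of a shape may contain
    non-symmetric matrices, at which the vanishing of the shape part has not been established. *)
Lemma near_line_is_derive (f g : V -> W) (x v : V) (d : W) :
  (\forall h \near (0 : R), f (h *: v + x) = g (h *: v + x)) ->
  is_derive x v g d -> is_derive x v f d.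
Proof.
move=> fg [dg <-].
have fg' : \forall h \near (0 : R)^',
    h^-1 *: (g (h *: v + x) - g x) = h^-1 *: (f (h *: v + x) - f x).
  have fgx : f x = g x by have := nbhs_singleton fg; rewrite scale0r add0r.
  by apply: cvg_within; apply: filterS fg => h ->; rewrite fgx.
have cf : (h^-1 *: (f (h *: v + x) - f x)) @[h --> 0^'] --> 'D_v g x.
  exact: cvg_trans (near_eq_cvg fg') dg.
split; first by apply/cvg_ex; exists ('D_v g x).
exact: cvg_lim cf.
Qed.

End SmoothAux.

Section ProductMaps.
Context {R : realType} {V : normedModType R}.
Implicit Types (phi : R -> R) (x v : R * V).

Lemma is_derive_fst phi x v l : is_derive x.1 1 phi l ->
  differentiable (phi \o fst) x /\ is_derive x v (phi \o fst) (v.1 * l).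
Proof.
move=> dphi.
have dp : differentiable phi x.1 by apply/derivable1_diffP; exact: ex_derive.
have df : differentiable (@fst R V) x by apply: linear_differentiable; exact: fst_continuous.
have dc : differentiable (phi \o fst) x by exact: differentiable_comp.
split=> //; split; first exact: diff_derivable.
rewrite (deriveE _ dc) (diff_comp df dp) /= (diff_lin _ (@fst_continuous _ _ _)).
have -> : 'd phi (x.1) (v.1) = v.1 *: 'd phi (x.1) 1.
  by rewrite -linearZ /= -[v.1 *: 1]/(v.1 * 1) mulr1.
by rewrite -derive1E'// derive1E (@derive_val _ _ _ _ _ _ _ dphi).
Qed.

Lemma is_derive_pair_map phi x v l (k : R) (b : V) : is_derive x.1 1 phi l ->
  differentiable (fun y : R * V => (phi y.1, k *: y.2 + b)) x /\
  is_derive x v (fun y : R * V => (phi y.1, k *: y.2 + b)) (v.1 * l, k *: v.2).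
Proof.
move=> dphi; have [d1 i1] := is_derive_fst v dphi.
have ds : differentiable (@snd R V) x by apply: linear_differentiable; exact: snd_continuous.
have dk : differentiable (k \*: (@snd R V)) x by exact: differentiableZ.
have d2 : differentiable ((k \*: (@snd R V)) + cst b) x by exact: differentiableD.
have d12 : differentiable (fun y : R * V => (phi y.1, k *: y.2 + b)) x
  by exact: (differentiable_pair d1 d2).
split=> //; split; first exact: diff_derivable.
rewrite (deriveE _ d12) (diff_pair d1 d2) /= -(deriveE _ d1) (@derive_val _ _ _ _ _ _ _ i1).
by rewrite diffD// diff_cst diffZ// (diff_lin _ (@snd_continuous _ _ _)) /= addr0.
Qed.

Let U : set (R * V) := [set x | 0 < x.1].

Let open_U : open U.
Proof.
apply: (@open_comp _ _ (@fst R V) [set y | 0 < y]); last exact: open_gt.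
by move=> x _; exact: fst_continuous.
Qed.

(** The sequence [phi] lists successive derivatives. The maps (c phi_n(a), kappa z + b) form a
    family stable under directional derivatives: in direction v, c becomes v_1 c, n becomes n + 1,
    kappa becomes 0 and b becomes kappa v_2. Hence an induction on the order over the whole
    family. *)
Lemma smooth_pair_map (phi : nat -> R -> R) :
  (forall n (x : R), 0 < x -> is_derive x 1 (phi n) (phi n.+1 x)) ->
  smooth_on U (fun x : R * V => (phi 0%N x.1, x.2)).
Proof.
move=> dphi.
have dn n (c : R) (x : R) : 0 < x -> is_derive x 1 (fun y => c * phi n y) (c * phi n.+1 x).
  by move=> x0; apply: is_deriveZ; exact: dphi.
suff H k : forall n (c kappa : R) (b : V),
    Ck_on k U (fun x : R * V => (c * phi n x.1, kappa *: x.2 + b)).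
  move=> k; apply: (Ck_on_ext open_U) (H k 0%N 1 1 0) => x _.
  by rewrite mul1r scale1r addr0.
elim: k => [|k IH] n c kappa b.
  move=> x Ux; apply: differentiable_continuous.
  exact: (is_derive_pair_map 0 kappa b (dn n c _ Ux)).1.
split=> [x Ux|v]; first exact: (is_derive_pair_map 0 kappa b (dn n c _ Ux)).1.
apply: (Ck_on_ext open_U) (IH n.+1 (v.1 * c) 0 (kappa *: v.2)) => x Ux.
have [_ i] := is_derive_pair_map v kappa b (dn n c _ Ux).
by rewrite (@derive_val _ _ _ _ _ _ _ i) scale0r add0r mulrA.
Qed.

Lemma smooth_pair_curve (phi : nat -> R -> R) (b : V) (I : set R) :
  (forall n (x : R), is_derive x 1 (phi n) (phi n.+1 x)) ->
  smooth_on I (fun t : R => (phi 0%N t, b)).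
Proof.
move=> dphi.
have dn n (c x : R) : is_derive x 1 (fun y => c * phi n y) (c * phi n.+1 x).
  exact: is_deriveZ.
have dd n (c : R) (b' : V) (x : R) : differentiable (fun t : R => (c * phi n t, b')) x.
  apply: (differentiable_pair (f := fun t => c * phi n t) (g := cst b')) => //.
  by apply/derivable1_diffP; exact: ex_derive.
suff H k : forall n (c : R) (b' : V), Ck_on k I (fun t : R => (c * phi n t, b')).
  move=> k; have := H k 0%N 1 b; congr (Ck_on _ _ _).
  by apply/funext => t; rewrite mul1r.
elim: k => [|k IH] n c b'; first by move=> x _; exact: differentiable_continuous.
split=> // v; have := IH n.+1 (v * c) 0; congr (Ck_on _ _ _).
apply/funext => x; rewrite deriveE//.
rewrite -[v in RHS]mulr1 -[v * 1 in RHS]/(v *: 1) linearZ /= -derive1E'//.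
have [d1 e1] := derive1_pair (@ex_derive _ _ _ _ _ _ _ (dn n c x)) (derivable_cst b' x 1).
rewrite -[derive1 _ _]/(derive1 (fun s => (c * phi n s, cst b' s)) x) e1.
rewrite derive1_cst derive1E (@derive_val _ _ _ _ _ _ _ (dn n c x)).
by rewrite -[RHS]/(v * _, v *: 0) scaler0 mulrA.
Qed.

End ProductMaps.

(** * The cone chart: isometry and radial geodesics *)

Section ConeCoordinates.
Context {R : realType} {d : nat}.
Local Notation mean_cov := ('cV[R]_d * 'M[R]_d)%type.
Variable r : R.
Hypothesis r0 : 0 < r.
Local Notation gU := (@gauss_plus R d r).
Local Notation h := (@gauss_shape R d r).
Local Notation radius := (@cone_radius R d r).
Implicit Types (x y v w : R * mean_cov) (mu : mean_cov).

(** The n-th derivative of 2 sqrt(r a) for a > 0, with the power a^(1/2 - n) written as a^-n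
    sqrt(a). *)
Definition sqrt_derivs (n : nat) (a : R) : R :=
  2 * Num.sqrt r * \prod_(i < n) (2^-1 - i%:R) * (a^-1 ^+ n * Num.sqrt a).

(** Derivatives of the mass along the radial curve rho + k t; the values rho = 0 and k = 1 give the
    mass component of [of_cone]. *)
Definition parabola_derivs (rho k : R) (n : nat) (t : R) : R :=
  match n with
  | 0 => (rho + k * t) ^+ 2 / (4 * r)
  | 1 => k * (rho + k * t) / (2 * r)
  | 2 => k ^+ 2 / (2 * r)
  | _ => 0
  end.

Lemma sqrt_derivsP n (a : R) : 0 < a ->
  is_derive a 1 (sqrt_derivs n) (sqrt_derivs n.+1 a).
Proof.
move=> a0.
suff H m : is_derive a 1 (fun y : R => y^-1 ^+ m * Num.sqrt y)
    ((2^-1 - m%:R) * (a^-1 ^+ m.+1 * Num.sqrt a)).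
  pose C := 2 * Num.sqrt r * \prod_(i < n) (2^-1 - i%:R).
  apply: (is_derive_eq (is_deriveZ C (H n))).
  by rewrite -[_ *: _]/(_ * _) /C /sqrt_derivs big_ord_recr /=; ring.
elim: m => [|m IH].
  rewrite (_ : (fun _ => _) = Num.sqrt); last by apply/funext => y; rewrite expr0 mul1r.
  rewrite subr0 expr1 (_ : 2^-1 * _ = (2 * Num.sqrt a)^-1); first exact: is_derive1_sqrt.
  rewrite invfM -{1}(sqr_sqrtr (ltW a0)); field.
  by rewrite gt_eqF// sqrtr_gt0.
rewrite (_ : (fun _ => _) =
    (fun y : R => y^-1) \* (fun y : R => y^-1 ^+ m * Num.sqrt y)); last first.
  by apply/funext => y /=; rewrite exprS mulrA.
have i1 : is_derive a 1 (fun y : R => y^-1) (- a^-1 ^+ 2).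
  have an0 : a != 0 by rewrite gt_eqF.
  by apply: (is_derive_eq (is_deriveV an0 (is_derive_id a 1)));
    rewrite -[_ *: _]/(_ * _) mulr1 exprVn.
apply: (is_derive_eq (is_deriveM i1 IH)); rewrite -![_ *: _]/(_ * _) !exprS -natr1; ring.
Qed.

Lemma parabola_derivsP (rho k : R) n (t : R) :
  is_derive t 1 (parabola_derivs rho k n) (parabola_derivs rho k n.+1 t).
Proof.
case: n => [|[|[|n]]] /=.
- by apply: is_derive_eq; rewrite ?scaler0 ?add0r ?addr0 -?[_ *: _]/(_ * _); field; rewrite gt_eqF.
- by apply: is_derive_eq; rewrite ?scaler0 ?add0r ?addr0 -?[_ *: _]/(_ * _); field; rewrite gt_eqF.
- exact: is_derive_cst.
- exact: is_derive_cst.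
Qed.

Lemma to_coneE : @to_cone R d r = fun x => (sqrt_derivs 0 x.1, x.2).
Proof.
apply/funext => x; rewrite /to_cone /cone_radius /sqrt_derivs big_ord0.
by rewrite expr0 mulr1 mul1r sqrtrM ?mulrA// ltW.
Qed.

Lemma of_coneE : @of_cone R d r = fun y => (parabola_derivs 0 1 0 y.1, y.2).
Proof. by apply/funext => y; rewrite /of_cone /parabola_derivs add0r mul1r. Qed.

Lemma sqrt_derivs1 (a : R) : 0 < a -> sqrt_derivs 1 a = r / Num.sqrt (r * a).
Proof.
move=> a0; rewrite /sqrt_derivs big_ord1 subr0 expr1 sqrtrM ?(ltW r0)//.
rewrite -{2}(sqr_sqrtr (ltW r0)) -{1}(sqr_sqrtr (ltW a0)); field.
by rewrite !gt_eqF// sqrtr_gt0.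
Qed.

Lemma is_derive_to_cone x v : 0 < x.1 ->
  is_derive x v (@to_cone R d r) (v.1 * (r / Num.sqrt (r * x.1)), v.2).
Proof.
move=> a0; have [_ i] := is_derive_pair_map v 1 0 (sqrt_derivsP 0 a0).
rewrite (_ : @to_cone R d r = fun y => (sqrt_derivs 0 y.1, 1 *: y.2 + 0)); last first.
  by rewrite to_coneE; apply/funext => y; rewrite scale1r addr0.
by apply: (is_derive_eq i); rewrite scale1r sqrt_derivs1.
Qed.

Lemma derive_radius x v : 0 < x.1 -> 'D_v radius x = v.1 * (r / Num.sqrt (r * x.1)).
Proof.
move=> a0; have [_ i] := is_derive_fst v (sqrt_derivsP 0 a0).
rewrite (_ : radius = sqrt_derivs 0 \o fst); last first.
  by apply/funext => y; have := congr1 (fun f => (f y).1) to_coneE.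
by rewrite (@derive_val _ _ _ _ _ _ _ i) sqrt_derivs1.
Qed.

Lemma metric_cone_coordinates x v : 0 < x.1 ->
  metric gU x v = (v.1 * (r / Num.sqrt (r * x.1))) ^+ 2 + radius x ^+ 2 * metric h x.2 v.2.
Proof.
move=> a0 /=; have ra0 : 0 <= r * x.1 by rewrite ltW// mulr_gt0.
rewrite /cone_radius !exprMn exprVn !sqr_sqrtr//; field.
by rewrite !gt_eqF.
Qed.

Lemma cone_isometry : riem_isometry gU (riem_cone h) (@to_cone R d r) (@of_cone R d r).
Proof.
split.
- move=> [a mu] [a0 Sp]; rewrite /to_cone of_coneK//; split=> //; split=> //.
  exact: radius_gt0.
- move=> [rho mu] [/= rho0 Sp]; split; first by split=> //=; rewrite divr_gt0 ?exprn_gt0// mulr_gt0.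
  by rewrite /to_cone radius_radial// ltW.
(* The carrier need not be open in the ambient space, because covariances are symmetric; the
   half-space of positive mass is open and the formula is smooth on it. *)
- exists [set x | 0 < x.1], (@to_cone R d r); split=> //.
  + apply: (@open_comp _ _ (@fst R mean_cov) [set y | 0 < y]); last exact: open_gt.
    by move=> x _; exact: fst_continuous.
  + by move=> x [].
  + rewrite to_coneE; apply: smooth_pair_map => n a; exact: sqrt_derivsP.
- exists [set x | 0 < x.1], (@of_cone R d r); split=> //.
  + apply: (@open_comp _ _ (@fst R mean_cov) [set y | 0 < y]); last exact: open_gt.
    by move=> x _; exact: fst_continuous.
  + by move=> x [].
  + rewrite of_coneE; apply: smooth_pair_map => n a _; exact: parabola_derivsP.
- move=> x v [a0 Sp] tv; rewrite (@derive_val _ _ _ _ _ _ _ (is_derive_to_cone v a0)).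
  by split=> //; rewrite metric_cone_coordinates.
Qed.

(** The radial direction is orthogonal to the shape directions: the parallel sum is even, so its two
    contributions to the polarization cancel. *)
Lemma inner_radial (rho k : R) mu w : 0 < rho ->
  inner gU (of_cone r (rho, mu)) (k * rho / (2 * r), 0) w = 2 * r * k * w.1 / rho.
Proof.
move=> rho0; rewrite /inner /= add0r sub0r g_parN// /of_cone /=; field.
by rewrite !gt_eqF.
Qed.

(** Both sides of the geodesic equation equal -2 r k^2 w_1 / rho^2. On the right only the
    coefficient r / a is differentiated, the shape part being zero at a radial velocity. *)
Lemma radial_geodesic mu (rho0 k : R) : gauss1 mu ->
  geodesic_on gU [set t : R | 0 < rho0 + k * t]
    (fun t : R => of_cone r (rho0 + k * t, mu)).
Proof.
move=> Sp; split.
- by move=> t /= ht; split=> //=; rewrite divr_gt0 ?exprn_gt0// mulr_gt0.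
- exact: (smooth_pair_curve mu [set t : R | 0 < rho0 + k * t] (parabola_derivsP rho0 k)).
move=> t w /= rho_gt0 tw; set rho := rho0 + k * t in rho_gt0 *.
rewrite (derive1_radial r0 rho0 k t mu).2 -/rho.
set x := of_cone r (rho, mu).
have x0 : 0 < x.1 by rewrite /= divr_gt0 ?exprn_gt0// mulr_gt0.
(* Used in the mass, with b = 0 and e = 1, and in time, with b = rho0 and e = k. *)
have dinv (K a b e : R) : b + e * a != 0 ->
    is_derive a 1 (fun y : R => K * (b + e * y)^-1) (- (K * e) / (b + e * a) ^+ 2).
  move=> be0; have i1 : is_derive a 1 (fun y : R => b + e * y) e.
    apply: (is_derive_eq (is_deriveD (is_derive_cst b a 1) (is_deriveZ e (is_derive_id a 1)))).
    by rewrite add0r -[_ *: _]/(_ * _) mulr1.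
  have i2 := @is_deriveV _ (fun y : R => b + e * y) a e 1 be0 i1.
  apply: (is_derive_eq (is_deriveZ K i2)).
  by rewrite -![_ *: _]/(_ * _); field.
pose psi (a : R) := r * (k * rho / (2 * r)) ^+ 2 * (0 + 1 * a)^-1.
have dpsi : is_derive x.1 1 psi (- (r * (k * rho / (2 * r)) ^+ 2 * 1) / (0 + 1 * x.1) ^+ 2).
  by apply: dinv; rewrite add0r mul1r gt_eqF.
have i : is_derive x w (fun y => metric gU y (k * rho / (2 * r), 0))
    (w.1 * (- (r * (k * rho / (2 * r)) ^+ 2 * 1) / (0 + 1 * x.1) ^+ 2)).
  apply: near_line_is_derive (is_derive_fst w dpsi).2.
  near=> s; have Ss : gauss1 (s *: w.2 + mu) by rewrite addrC; near: s; exact: gauss1_near.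
  by rewrite /= g_par0// mulr0 addr0 /psi add0r mul1r; ring.
split; first exact: (@ex_derive _ _ _ _ _ _ _ i).
rewrite (@derive_val _ _ _ _ _ _ _ i).
have near_pos : \forall s \near t, 0 < rho0 + k * s.
  have cr : (rho0 + k * s) @[s --> t] --> rho0 + k * t.
    by apply: cvgD; [exact: cvg_cst|exact: mulrl_continuous].
  exact: (cvgr_gt _ cr).
have j : is_derive t 1 (fun s : R => 2 * r * k * w.1 * (rho0 + k * s)^-1)
    (- (2 * r * k * w.1 * k) / (rho0 + k * t) ^+ 2).
  by apply: dinv; rewrite gt_eqF.
have E : {near t, (fun s => 2 * r * k * w.1 * (rho0 + k * s)^-1) =1
    (fun s => inner gU (of_cone r (rho0 + k * s, mu))
       (derive1 (fun u => of_cone r (rho0 + k * u, mu)) s) w)}.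
  by apply: filterS near_pos => s hs; rewrite (derive1_radial r0 rho0 k s mu).2 inner_radial.
split.
  by apply: near_eq_derivable E (@ex_derive _ _ _ _ _ _ _ j).
rewrite -(near_eq_derive _ E) (@derive_val _ _ _ _ _ _ _ j) -/rho /x /=; field.
by rewrite !gt_eqF.
Unshelve. all: by end_near. Qed.

End ConeCoordinates.

(** * The apex *)

Section Apex.
Context {R : realType} {d : nat}.
Local Notation mean_cov := ('cV[R]_d * 'M[R]_d)%type.
Variable r : R.
Hypothesis r0 : 0 < r.
Local Notation gU := (@gauss_plus R d r).
Local Notation radius := (@cone_radius R d r).
Local Notation M := (carrier gU).
Local Notation dist := (riem_dist gU).
Implicit Types (x y z al : R * mean_cov) (mu nu : mean_cov).

Let D x y : R := fine (dist x y).

Let distE x y : M x -> M y -> dist x y = (D x y)%:E.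
Proof. by move=> Mx My; rewrite fineK// gauss_plus_dist_fin. Qed.

Let D_refl x : M x -> D x x = 0.
Proof.
by case: x => a mu [/= a0 Sm]; rewrite /D gauss_plus_radial_dist// subrr normr0.
Qed.

Let D_sym x y : M x -> M y -> D x y = D y x.
Proof. by move=> Mx My; rewrite /D (riem_dist_sym (gauss_plus_metricZ r)). Qed.

Let D_triangle x y z : M x -> M y -> M z -> D x z <= D x y + D y z.
Proof.
move=> Mx My Mz; rewrite -lee_fin EFinD -!distE//.
exact: (riem_dist_triangle (gauss_plus_metricZ r)).
Qed.

Let D_ge x y : M x -> M y -> `|radius y - radius x| <= D x y.
Proof. by move=> Mx My; rewrite -lee_fin -distE// gauss_plus_dist_ge. Qed.

Let D_radial mu (a b : R) : gauss1 mu -> 0 < a -> 0 < b ->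
  D (a, mu) (b, mu) = `|radius (b, mu) - radius (a, mu)|.
Proof. by move=> Sm a0 b0; rewrite /D gauss_plus_radial_dist. Qed.

Definition apex_seq (n : nat) : R * mean_cov := (n.+1%:R^-1, (0, 1%:M)).

Let M_apex_seq n : M (apex_seq n).
Proof. by split; [rewrite /= invr_gt0|exact: spd1]. Qed.

Let cvg_sqrt0 {T : Type} {F : set_system T} {FF : Filter F} (f : T -> R) :
  f x @[x --> F] --> (0 : R) -> Num.sqrt (f x) @[x --> F] --> (0 : R).
Proof.
move=> f0; rewrite -[X in _ --> X](@sqrtr0 R).
apply: continuous_cvg => //; exact: sqrt_continuous.
Qed.

Let radius_apex_seq : radius (apex_seq n) @[n --> \oo] --> (0 : R).
Proof.
rewrite -[X in _ --> X](mulr0 2); apply: cvgM; first exact: cvg_cst.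
apply: cvg_sqrt0; rewrite -[X in _ --> X](mulr0 r).
by apply: cvgM; [exact: cvg_cst|exact: cvg_harmonic].
Qed.

(** From below, the distance is at least the difference of radii. From above, move radially to mass
    1/(n + 1), then change the shape at that mass, at cost C / sqrt(n + 1). *)
Let D_apex_seq al : M al -> D al (apex_seq n) @[n --> \oo] --> radius al.
Proof.
case: al => a mu [/= a0 Sm].
have [C C0 hC] := gauss_plus_shape_dist r0 Sm (@spd1 R d : gauss1 (0, 1%:M)).
set p := (a, mu).
apply: (@squeeze_cvgr _ _ _ _ (fun n => radius p - radius (apex_seq n))
  (fun n => radius p + radius (apex_seq n) + C * Num.sqrt (n.+1%:R^-1))).
- apply: nearW => n; apply/andP; split.
    rewrite (le_trans _ (D_ge _ _))//; first by rewrite distrC ler_norm.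
  have e0 : 0 < n.+1%:R^-1 :> R by rewrite invr_gt0.
  have h1 : D p (apex_seq n) <= D p (n.+1%:R^-1, mu) + D (n.+1%:R^-1, mu) (apex_seq n).
    by apply: D_triangle.
  have h2 : D (n.+1%:R^-1, mu) (apex_seq n) <= C * Num.sqrt n.+1%:R^-1.
    by rewrite -lee_fin -distE//; exact: hC.
  rewrite D_radial// in h1; apply: (le_trans h1); rewrite lerD//.
  rewrite (le_trans (ler_normB _ _))// addrC.
  by rewrite !gtr0_norm//; exact: radius_gt0.
- by rewrite -[X in _ --> X]subr0; apply: cvgB => //; exact: cvg_cst.
- rewrite -[X in _ --> X]addr0 -[X in X + _]addr0 -[X in _ --> _ + X](mulr0 C).
  apply: cvgD; first by apply: cvgD => //; exact: cvg_cst.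
  by apply: cvgM; [exact: cvg_cst|apply: cvg_sqrt0; exact: cvg_harmonic].
Qed.

(** The sequence lies on one ray, where distances are differences of radii, and the radii tend to
    0. *)
Lemma cauchy_apex_seq : cauchy_seq_in M dist apex_seq.
Proof.
split=> // e e0.
have /cvgr0Pnorm_lt/(_ (e / 2)) : radius (apex_seq n) @[n --> \oo] --> (0 : R) by [].
rewrite divr_gt0// => /(_ isT)[N _ hN]; exists N => m n Nm Nn.
rewrite distE// lte_fin D_radial ?invr_gt0//; last exact: spd1.
by rewrite (splitr e) (le_lt_trans (ler_normB _ _))// ltrD//; exact: hN.
Qed.

Definition apex : set (nat -> R * mean_cov) := cauchy_class M dist apex_seq.

Local Notation compl := (completion M dist).
Local Notation embed := (completion_embed M dist).
Local Notation cdist := (completion_dist dist).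

Lemma cdist_embed_apex al : M al -> cdist (embed al) apex = (radius al)%:E.
Proof.
move=> Ma; apply: (completion_distE distE D_refl D_sym D_triangle).
- exact: (cauchy_seq_in_cst distE D_refl).
- exact: cauchy_apex_seq.
- exact: D_apex_seq.
Qed.

Let D_apex_seqC al : M al -> D (apex_seq n) al @[n --> \oo] --> radius al.
Proof.
move=> Ma; rewrite (_ : (fun n => _) = (fun n => D al (apex_seq n))).
  exact: D_apex_seq.
by apply/funext => n; exact: D_sym.
Qed.

Lemma cdist_apex_embed al : M al -> cdist apex (embed al) = (radius al)%:E.
Proof.
move=> Ma; apply: (completion_distE distE D_refl D_sym D_triangle).
- exact: cauchy_apex_seq.
- exact: (cauchy_seq_in_cst distE D_refl).
- exact: D_apex_seqC.
Qed.

(** Equality of the classes would make the distances from [apex_seq] to [al] tend to 0, while they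
    tend to the positive radius of [al]. *)
Lemma embed_neq_apex al : M al -> embed al <> apex.
Proof.
move=> Ma E; have cal := cauchy_seq_in_cst distE D_refl Ma.
have : embed al (fun=> al) by exact: (cauchy_class_refl distE D_refl).
rewrite E => /(cauchy_classP distE _ cauchy_apex_seq)[_].
move=> /(cvg_unique (@Rhausdorff R) (D_apex_seqC Ma)) /eqP.
by rewrite gt_eqF// radius_gt0//; case: Ma.
Qed.

Lemma cvg_radius_right mu : radius (a, mu) @[a --> (0 : R)^'+] --> (0 : R).
Proof.
rewrite -[X in _ --> X](mulr0 2); apply: cvgM; first exact: cvg_cst.
apply: cvg_sqrt0; rewrite -[X in _ --> X](mulr0 r).
by apply: cvgM; [exact: cvg_cst|apply: cvg_at_right_filter; exact: cvg_id].
Qed.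

Lemma embed_cvg_apex mu : gauss1 mu ->
  cdist (embed (a, mu)) apex @[a --> (0 : R)^'+] --> 0%E.
Proof.
move=> Sm; have : (radius (a, mu))%:E @[a --> (0 : R)^'+] --> (0 : R)%:E.
  by apply: cvg_EFin; [exact: nearW|exact: cvg_radius_right].
apply: cvg_trans; apply: near_eq_cvg; near=> a.
by rewrite cdist_embed_apex//; split=> //=; near: a; exact: nbhs_right_gt.
Unshelve. all: by end_near. Qed.

(** A single mass a is fixed for which [(a, mu)] is within e/3 of p and has radius below e/3. For
    large n it is then that close to both [z n] and [apex_seq n], so these two are less than e
    apart. *)
Lemma apex_unique mu p : gauss1 mu -> compl p ->
  cdist (embed (a, mu)) p @[a --> (0 : R)^'+] --> 0%E -> p = apex.
Proof.
move=> Sm [z cz <-] /fine_cvgP[_ hp].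
apply: (cauchy_class_eq distE D_refl D_sym D_triangle cz cauchy_apex_seq).
apply/cvgr0Pnorm_lt => e e0; have e3 : 0 < e / 3 by rewrite divr_gt0.
have [a [a0 h1 h2]] : exists a : R, [/\ 0 < a,
    `|fine (cdist (embed (a, mu)) (cauchy_class M dist z))| < e / 3 &
    `|radius (a, mu)| < e / 3].
  apply: (@filter_ex _ (0 : R)^'+); near=> a; split.
  - by near: a; exact: nbhs_right_gt.
  - by near: a; exact: ((cvgr0Pnorm_lt _).1 hp _ e3).
  - by near: a; exact: ((cvgr0Pnorm_lt _).1 (cvg_radius_right mu) _ e3).
have Ma : M (a, mu) by [].
have /cvg_ex[l hl] := cauchy_D_cvg distE D_refl D_sym D_triangle Ma cz.
have cE : cdist (embed (a, mu)) (cauchy_class M dist z) = l%:E.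
  apply: (completion_distE distE D_refl D_sym D_triangle) => //.
  exact: (cauchy_seq_in_cst distE D_refl).
rewrite cE /= in h1.
have l3 : l < e / 3 by rewrite (le_lt_trans (ler_norm _)).
have r3 : radius (a, mu) < e / 3 by rewrite (le_lt_trans (ler_norm _)).
near=> n.
have n1 : D (a, mu) (z n) < e / 3 by near: n; exact: (cvgr_lt l).
have n2 : D (a, mu) (apex_seq n) < e / 3.
  by near: n; apply: (cvgr_lt (radius (a, mu))) => //; exact: D_apex_seq.
have Mz := cz.1 n.
have n3 := D_triangle Mz Ma (M_apex_seq n); rewrite (D_sym Mz Ma) in n3.
have n4 : 0 <= D (z n) (apex_seq n) by rewrite (le_trans _ (D_ge _ _)).
by rewrite ger0_norm//; lra.
Unshelve. all: by end_near. Qed.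

End Apex.

Theorem theorem4p5 (R : realType) (d : nat) (tau0 tau1 r : R)
    (htau0 : 0 < tau0) (htau1 : 0 < tau1)
    (hr : r = tau0 * tau1 / (2 * (tau0 + tau1))) :
  let gU : riem_space (R * ('cV[R]_d * 'M[R]_d))%type := gauss_plus r in
  let h : riem_space ('cV[R]_d * 'M[R]_d)%type := gauss_shape r in
  let dist := riem_dist gU in
  let compl := completion (carrier gU) dist in
  let embed := completion_embed (carrier gU) dist in
  let cdist := completion_dist dist in
  [/\ (* g^U = drho^2 + rho^2 h *)
      forall al v, carrier gU al -> tangent gU v ->
        metric gU al v =
          ('D_v (cone_radius r) al) ^+ 2 + cone_radius r al ^+ 2 * metric h al.2 v.2,
      (* isometry with the open Riemannian cone over h *)
      riem_isometry gU (riem_cone h) (to_cone r) (of_cone r),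
      (* radial curves, parametrized affinely in rho, are geodesics *)
      forall mu (rho0 c : R), carrier h mu ->
        geodesic_on gU [set t : R | 0 < rho0 + c * t]
          (fun t : R => of_cone r (rho0 + c * t, mu)),
      (* radial distances *)
      forall mu (a0 a1 : R), carrier h mu -> 0 < a0 -> 0 < a1 ->
        dist (a0, mu) (a1, mu) =
          (2 * Num.sqrt r * `|Num.sqrt a1 - Num.sqrt a0|)%:E &
      (* the cone apex in the metric completion *)
      exists apex, compl apex /\
        [/\ forall mu, carrier h mu ->
              cdist (embed (a, mu)) apex @[a --> (0 : R)^'+] --> 0%E,
            forall mu p, carrier h mu -> compl p ->
              cdist (embed (a, mu)) p @[a --> (0 : R)^'+] --> 0%E -> p = apex,
            forall al, carrier gU al -> embed al <> apex &
            forall mu (a : R), carrier h mu -> 0 < a ->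
              cdist apex (embed (a, mu)) = (2 * Num.sqrt (r * a))%:E]].
Proof.
have r0 : 0 < r by rewrite hr divr_gt0 ?mulr_gt0 ?addr_gt0.
move=> gU h dist compl embed cdist; split.
- by move=> al v [a0 _] _; rewrite metric_cone_coordinates// derive_radius.
- exact: cone_isometry.
- by move=> mu rho0 c; exact: radial_geodesic.
- move=> mu a0 a1 Sm a00 a10; rewrite /dist gauss_plus_radial_dist//.
  by rewrite /cone_radius /= !sqrtrM ?(ltW r0)// !mulrA -mulrBr normrM ger0_norm//.
exists (@apex R d r); split.
  by exists (@apex_seq R d) => //; exact: cauchy_apex_seq.
split.
- by move=> mu; exact: embed_cvg_apex.
- by move=> mu p; exact: apex_unique.
- by move=> al; exact: embed_neq_apex.
- by move=> mu a Sm a0; rewrite /cdist /embed cdist_apex_embed.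
Qed.
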